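(* Let $k$ be a natural number, let $G$ be a 3-connected cubic graph and let $\Theta=(P_1,P_2,P_3)$ be a short $\theta$-graph in $G$. If $G-\Theta^+$ has at least $8k$ vertices of degree at most 1, then $G$ is $k$-good.
   Context: All graphs are finite and simple. For a subgraph $H$ of $G$, $G-H$ is obtained by deleting the vertices of $H$. A subcubic graph has maximum degree at most 3. An $A-B$ path is a path with one end in $A$, one end in $B$, and no internal vertex in $A\cup B$. A $\theta$-graph (or $u,v$-$\theta$-graph) $\Theta=(P_1,P_2,P_3)$ consists of two vertices $u,v$ and three pairwise internally disjoint $u-v$ paths $P_1,P_2,P_3$ (its legs). A shortest $u,v$-$\theta$-graph in $G$ is a $u,v$-$\theta$-graph in $G$ with the minimum number of edges; a short $\theta$-graph is a shortest $u,v$-$\theta$-graph for some vertices $u,v$. $F(\Theta)$ is the set of vertices of $G-\Theta$ having at least two neighbours in $\Theta$, and $\Theta^+$ is the subgraph of $G$ induced by $V(\Theta)\cup F(\Theta)$. $k$-good: a $\theta(k,i)$-necklace is a connected subcubic graph consisting of $k$ disjoint $\theta$-graphs $\Theta_1,\dots,\Theta_k$ and $k$ disjoint paths $Q_1,\dots,Q_k$ such that $\Theta_j$ has legs $L_{j,1},L_{j,2},L_{j,3}$ with $L_{j,3}$ of length $i$, $Q_j$ is an $L_{j,2}-L_{j+1,1}$ path for $j<k$, $Q_k$ is an $L_{k,2}-L_{1,1}$ path, and no interior vertex of any $Q_j$ lies in any $\Theta_{j'}$. Two subgraphs are $k$-close if they are disjoint and joined by $k$ pairwise disjoint paths of length at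 most 2 (each having one end in each subgraph and no internal vertex in either). For pairwise disjoint 2-connected subgraphs $B_1,\dots,B_\ell$ of $G$, a necklace on them consists of the $B_i$ together with pairwise disjoint paths $Q_1,\dots,Q_\ell$, $Q_i$ a $B_i-B_{i+1}$ path ($Q_\ell$ a $B_\ell-B_1$ path), with no interior vertex of any $Q_i$ in any $B_j$; letting $x_i,y_i$ be the two vertices of $B_i$ lying on some $Q_j$, it is $k$-wiggly if for at least $k$ indices $i$, $B_i$ contains two $x_i-y_i$ paths whose lengths differ by 1 or 2. A graph is $k$-good if it contains a $\theta(k,i)$-necklace with $i\in\{1,2\}$, a $k$-wiggly necklace, or a path and a cycle which are $k$-close. *)

(* Defs.v *)
From mathcomp Require Import all_boot.

Set Implicit Arguments.
Unset Strict Implicit.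
Unset Printing Implicit Defensive.

(* A finite simple graph whose vertices are taken from T.  The vertex set need
   not be all of T, so that the subgraphs of G : graph T are again in graph T. *)
Record graph (T : finType) := Graph {
  vset : {set T};
  eset : {set {set T}};
  graph_wf : [forall e in eset, (#|e| == 2) && (e \subset vset)]
}.

Section Graphs.
Variable T : finType.
Implicit Types (G H K N : graph T) (p q c : seq T) (x y u v : T).

Definition adj G : rel T := fun x y => [set x; y] \in eset G.

Lemma adj_sym G : symmetric (adj G).
Proof. by move=> x y; rewrite /adj setUC. Qed.

Lemma adj_irr G : irreflexive (adj G).
Proof.
move=> x; apply/negbTE/negP => Exx.
by have /forall_inP/(_ _ Exx) := graph_wf G; rewrite setUid cards1.
Qed.

Definition neighbours G x : {set T} := [set y | adj G x y].
Definition degree G x : nat := #|neighbours G x|.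
Definition cubic G : Prop := {in vset G, forall x, degree G x = 3}.
Definition subcubic G : Prop := {in vset G, forall x, degree G x <= 3}.

Definition subgraph H G : Prop :=
  vset H \subset vset G /\ eset H \subset eset G.

Definition gdisjoint H K : bool := [disjoint vset H & vset K].

Lemma induced_wf G (S : {set T}) :
  [forall e in [set e in eset G | e \subset S],
     (#|e| == 2) && (e \subset vset G :&: S)].
Proof.
apply/forall_inP => e; rewrite inE => /andP[eG eS].
by have /forall_inP/(_ e eG)/andP[-> eV] := graph_wf G; rewrite subsetI eV.
Qed.
Definition induced G S : graph T := Graph (induced_wf G S).

Definition gdelete G (S : {set T}) : graph T := induced G (~: S).

Lemma gunion_wf H K :
  [forall e in eset H :|: eset K,
     (#|e| == 2) && (e \subset vset H :|: vset K)].
Proof.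
apply/forall_inP => e /setUP[] eE.
  have /forall_inP/(_ e eE)/andP[-> /=] := graph_wf H.
  by move/subset_trans; apply; apply: subsetUl.
have /forall_inP/(_ e eE)/andP[-> /=] := graph_wf K.
by move/subset_trans; apply; apply: subsetUr.
Qed.
Definition gunion H K : graph T := Graph (gunion_wf H K).

Definition gconnected G : Prop :=
  vset G != set0 /\ {in vset G &, forall x y, connect (adj G) x y}.

Definition k_connected (k : nat) G : Prop :=
  k < #|vset G| /\
  forall S : {set T},
    S \subset vset G -> #|S| < k -> gconnected (gdelete G S).

(* Paths and cycles are given by their sequences of vertices. *)

Definition is_path G p : bool :=
  [&& p != [::], uniq p, all (mem (vset G)) p & sorted (adj G) p].

Definition is_cycle G c : bool :=
  [&& 2 < size c, uniq c & cycle (adj G) c].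

Definition plength p : nat := (size p).-1.

Definition interior p : seq T := behead (take (size p).-1 p).

Definition path_between G x y p : bool :=
  [&& is_path G p, head y p == x & last x p == y].

(* A path with an end in A, the other end in B, and no internal vertex in
   A :|: B, listed from its end in A. *)
Definition set_path G (A B : {set T}) p : bool :=
  [exists x in A, exists y in B, path_between G x y p]
  && [disjoint interior p & A :|: B].

(* The graph formed by the vertices and the steps of a sequence; the condition
   xy.1 != xy.2 is only there to make this a simple graph for every p. *)
Lemma walk_graph_wf p :
  [forall e in [set [set xy.1; xy.2] |
                 xy : T * T & (xy.1 != xy.2) && infix [:: xy.1; xy.2] p],
     (#|e| == 2) && (e \subset [set x in p])].
Proof.
apply/forall_inP => e /imsetP[[x y]]; rewrite inE /= => /andP[xy sp ->].
rewrite cards2 xy /=; apply/subsetP => z; rewrite !inE => zxy.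
by apply: (mem_infix sp); rewrite !inE.
Qed.
Definition walk_graph p : graph T := Graph (walk_graph_wf p).

Definition path_graph p : graph T := walk_graph p.
Definition cycle_graph c : graph T := walk_graph (c ++ take 1 c).

Definition theta_graph p1 p2 p3 : graph T :=
  gunion (path_graph p1) (gunion (path_graph p2) (path_graph p3)).

(* The legs are required to be distinct, because an edge uv is internally
   disjoint from itself. *)
Definition is_theta G u v p1 p2 p3 : Prop :=
  [/\ u != v,
      [/\ path_between G u v p1, path_between G u v p2
        & path_between G u v p3],
      uniq [:: p1; p2; p3]
    & [/\ [disjoint interior p1 & interior p2],
          [disjoint interior p1 & interior p3]
        & [disjoint interior p2 & interior p3]]].

Definition shortest_theta G u v p1 p2 p3 : Prop :=
  is_theta G u v p1 p2 p3 /\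
  forall q1 q2 q3, is_theta G u v q1 q2 q3 ->
    #|eset (theta_graph p1 p2 p3)| <= #|eset (theta_graph q1 q2 q3)|.

Definition short_theta G p1 p2 p3 : Prop :=
  exists u v, shortest_theta G u v p1 p2 p3.

Definition F_set G H : {set T} :=
  [set x in vset (gdelete G (vset H)) | 2 <= #|neighbours G x :&: vset H|].

Definition plus_graph G H : graph T := induced G (vset H :|: F_set G H).

Definition pairwise_disjoint (I : finType) (S : I -> {set T}) : Prop :=
  forall i j, i != j -> [disjoint S i & S j].

Definition consists_of (I : finType) N (A B : I -> graph T) : Prop :=
  vset N = \bigcup_i (vset (A i) :|: vset (B i)) /\
  eset N = \bigcup_i (eset (A i) :|: eset (B i)).

(* Indices are cyclic: ordS j is j + 1, and 0 if j is the last index. *)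
Definition theta_necklace (k i : nat) N : Prop :=
  exists (u v : 'I_k -> T) (L1 L2 L3 Q : 'I_k -> seq T),
    let Theta j := theta_graph (L1 j) (L2 j) (L3 j) in
    [/\ gconnected N /\ subcubic N,
        consists_of N Theta (fun j => path_graph (Q j)),
        [/\ forall j, is_theta N (u j) (v j) (L1 j) (L2 j) (L3 j),
            pairwise_disjoint (fun j => vset (Theta j))
          & forall j, plength (L3 j) = i]
      & [/\ forall j, set_path N [set x in L2 j] [set x in L1 (ordS j)] (Q j),
            pairwise_disjoint (fun j => [set x in Q j])
          & forall j j', [disjoint interior (Q j) & vset (Theta j')]]].

Definition k_close (k : nat) G H K : Prop :=
  gdisjoint H K /\
  exists R : 'I_k -> seq T,
    [/\ forall i, set_path G (vset H) (vset K) (R i),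
        forall i, plength (R i) <= 2
      & pairwise_disjoint (fun i => [set x in R i])].

Definition necklace (l : nat) N (B : 'I_l -> graph T) (Q : 'I_l -> seq T) :
    Prop :=
  [/\ 0 < l,
      consists_of N B (fun i => path_graph (Q i)),
      (forall i, k_connected 2 (B i)) /\
      pairwise_disjoint (fun i => vset (B i))
    & [/\ forall i, set_path N (vset (B i)) (vset (B (ordS i))) (Q i),
          pairwise_disjoint (fun i => [set x in Q i])
        & forall i j, [disjoint interior (Q i) & vset (B j)]]].

Definition wiggly_necklace (k : nat) N : Prop :=
  exists (l : nat) (B : 'I_l -> graph T) (Q : 'I_l -> seq T) (x y : 'I_l -> T),
    [/\ necklace N B Q,
        forall i, x i != y i /\
          [set z in vset (B i) | [exists j, z \in Q j]] = [set x i; y i]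
      & exists2 I : {set 'I_l}, k <= #|I| &
          forall i, i \in I -> exists p q,
            [/\ path_between (B i) (x i) (y i) p,
                path_between (B i) (x i) (y i) q
              & plength q = plength p + 1 \/ plength q = plength p + 2]].

Definition k_good (k : nat) G : Prop :=
  [\/ exists2 N, subgraph N G & theta_necklace k 1 N \/ theta_necklace k 2 N,
      exists2 N, subgraph N G & wiggly_necklace k N
    | exists p c, [/\ is_path G p, is_cycle G c
                    & k_close k G (path_graph p) (cycle_graph c)]].

End Graphs.

(* Main.v *)
Require Import Defs.
From mathcomp Require Import all_boot zify.

(* Let X be the set of vertices of degree at most 1 outside Theta^+.  A vertex
   x of X has a neighbour f in F(Theta), and either a neighbour in Theta or a
   second neighbour in F(Theta).  As G is cubic, the vertices of Theta reached
   from x directly or through F(Theta) are reached from no other vertex of X.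
   If f has neighbours in two legs, it gives a path of length 2 between them.
   Otherwise minimality of Theta puts its two neighbours at distance 1 or 2 on
   one leg.  At distance 1, f closes a triangle, which is a wiggle of that leg.
   At distance 2 one can reroute the leg through f, which brings x next to it:
   if x also reaches another leg, directly or through a second rerouting, this
   again gives a path of length 2 between two legs, and if x only reaches the
   same leg, minimality forces a 4-cycle through an edge of the leg or two
   overlapping detours, both of which are wiggles.  Paths of length 2 join one
   leg to the cycle formed by the other two, and wiggles are collected along
   the cycle formed by two legs.  The losses in the choice of the legs are at
   most 3/2, 3/2, 3/2 and 3 for the four kinds of vertices of X, and
   3/2 + 3/2 + 3/2 + 3 < 8. *)

Set Implicit Arguments.
Unset Strict Implicit.
Unset Printing Implicit Defensive.


(** [R] takes values in [Prop], so the choices are made one by one along [enum A]; [y0] is the value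
    where nothing has to be chosen. *)
Lemma finite_choice (T : finType) (Y : Type) (y0 : Y) (R : T -> Y -> Prop)
    (A : {set T}) :
  (forall x, x \in A -> exists y, R x y) ->
  exists f : T -> Y, forall x, x \in A -> R x (f x).
Proof.
move=> AR.
suff [f fP] : exists f : T -> Y, forall x, x \in enum A -> R x (f x).
  by exists f => x xA; apply: fP; rewrite mem_enum.
have: {subset enum A <= A} by move=> x; rewrite mem_enum.
elim: (enum A) => [|x s IHs] sA; first by exists (fun=> y0).
have [f fP] := IHs (fun z zs => sA z (mem_behead (s := x :: s) zs)).
have [y xy] := AR x (sA x (mem_head x s)).
exists (fun z => if z == x then y else f z) => z.
by rewrite inE; case: eqVneq => [-> //|_ /= /fP].
Qed.

(** * Paths and their edge sets *)

Section Basics.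
Variable T : finType.
Implicit Types (G H : graph T) (p q s : seq T).

Lemma adj_vset G x y : adj G x y -> x \in vset G.
Proof.
move=> xy; have /forall_inP/(_ _ xy)/andP[_ /subsetP] := graph_wf G.
by apply; rewrite !inE eqxx.
Qed.

Lemma adj_vsetr G x y : adj G x y -> y \in vset G.
Proof. by rewrite adj_sym; apply: adj_vset. Qed.

Lemma adj_neq G x y : adj G x y -> x != y.
Proof. by apply: contraTneq => ->; rewrite adj_irr. Qed.

Lemma path_all_vset G x p :
  x \in vset G -> path (adj G) x p -> all (mem (vset G)) p.
Proof.
elim: p x => //= y p IHp x _ /andP[xy yp].
by rewrite (adj_vsetr xy) /=; apply: IHp yp; apply: adj_vsetr xy.
Qed.

Lemma interior_cons_rcons x p y : interior (x :: rcons p y) = p.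
Proof. by rewrite /interior /= size_rcons /= -cats1 take_size_cat. Qed.

Lemma path_between_cons_rcons G x p y :
  path_between G x y (x :: rcons p y) =
  path (adj G) x (rcons p y) && uniq (x :: rcons p y).
Proof.
rewrite /path_between /is_path /= last_rcons !eqxx !andbT.
case: (boolP (path _ _ _)) => [xp|_]; last by rewrite !andbF.
have xV : x \in vset G by case: p xp => [|z p] /= /andP[/adj_vset].
by rewrite xV (path_all_vset xV xp) !andbT.
Qed.

Lemma path_between_interior G x y p :
  x != y -> path_between G x y p -> p = x :: rcons (interior p) y.
Proof.
move=> xy /and3P[/and4P[p0 _ _ _] hp lp].
case: p p0 hp lp => [//|z p] _ /= /eqP-> .
case/lastP: p => [|p w] /=; first by rewrite (negPf xy).
by rewrite last_rcons => /eqP->; rewrite interior_cons_rcons.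
Qed.

Lemma mem_path_graph p x : (x \in vset (path_graph p)) = (x \in p).
Proof. by rewrite inE. Qed.

Lemma eset_path_graphP p (e : {set T}) :
  reflect (exists x y, [/\ e = [set x; y], x != y & infix [:: x; y] p])
          (e \in eset (path_graph p)).
Proof.
apply: (iffP imsetP) => [[[x y]]|[x [y [-> xy i]]]].
  by rewrite inE /= => /andP[xy i] ->; exists x, y.
by exists (x, y) => //; rewrite inE /= xy.
Qed.

Lemma infix2_cons (x y a b : T) r :
  infix [:: x; y] [:: a, b & r] =
  ((x == a) && (y == b)) || infix [:: x; y] (b :: r).
Proof. by rewrite infix_consl /= prefix0s andbT. Qed.

Lemma eset_path_graph_cons (a b : T) r :
  a != b ->
  eset (path_graph [:: a, b & r]) = [set a; b] |: eset (path_graph (b :: r)).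
Proof.
move=> ab; apply/setP => e; rewrite !in_setU1.
apply/eset_path_graphP/orP => [[x [y [-> xy]]]|[/eqP->|/eset_path_graphP]].
- rewrite infix2_cons => /orP[/andP[/eqP-> /eqP->]|i]; first by left.
  by right; apply/eset_path_graphP; exists x, y.
- by exists a, b; rewrite infix2_cons !eqxx.
by move=> [x [y [-> xy i]]]; exists x, y; rewrite infix2_cons i orbT.
Qed.

Lemma eset_path_graph_sub p (e : {set T}) :
  e \in eset (path_graph p) -> {subset e <= p}.
Proof.
move=> ep z ze; have /forall_inP/(_ e ep)/andP[_ /subsetP/(_ z ze)] := graph_wf (path_graph p).
by rewrite inE.
Qed.

Lemma card_eset_path_graph p : uniq p -> #|eset (path_graph p)| = (size p).-1.
Proof.
elim: p => [|a [|b r] IHp] up.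
- apply/eqP; rewrite cards_eq0 -subset0; apply/subsetP => e /eset_path_graphP.
  by case=> x [y []].
- apply/eqP; rewrite cards_eq0 -subset0; apply/subsetP => e /eset_path_graphP.
  by case=> x [y [_ _]]; rewrite infix_consl /= andbF.
have ab : a != b by case/and3P: up; rewrite inE negb_or => /andP[].
rewrite eset_path_graph_cons // cardsU1 IHp //; last by case/andP: up.
case: (boolP (_ \in _)) => // /eset_path_graph_sub/(_ a); rewrite !inE eqxx.
by move/(_ isT); case/andP: up; rewrite inE => /negP.
Qed.

Lemma path_graph_sorted p : uniq p -> sorted (adj (path_graph p)) p.
Proof.
case: p => // a p; elim: p a => //= b r IHr a.
move=> /= /andP[an ubr]; have ab : a != b by move: an; rewrite inE negb_or => /andP[].
apply/andP; split; first by rewrite /adj eset_path_graph_cons // setU11.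
apply: sub_path (IHr b ubr) => x y; rewrite /adj eset_path_graph_cons // => xy.
by rewrite in_setU1 xy orbT.
Qed.

Lemma path_graph_subgraph G p :
  all (mem (vset G)) p -> sorted (adj G) p -> subgraph (path_graph p) G.
Proof.
move=> /allP pV sp; split; first by apply/subsetP => x; rewrite inE => /pV.
apply/subsetP => e /eset_path_graphP[x [y [-> _ /infixP[s1 [s2 E]]]]].
by move: sp; rewrite E => /cat_sorted2[_] /= /andP[].
Qed.

End Basics.


(** * Induced subgraphs and 2-connectedness *)

Section Induced.
Variable T : finType.
Implicit Types (G H : graph T) (p q s : seq T).

Lemma adj_induced G (S : {set T}) x y :
  adj (induced G S) x y = [&& adj G x y, x \in S & y \in S].
Proof. by rewrite {1}/adj inE subUset !sub1set. Qed.

Lemma induced_subgraph G (S : {set T}) : subgraph (induced G S) G.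
Proof. by split; [apply: subsetIl | apply/subsetP => e; rewrite inE => /andP[]]. Qed.

Lemma path_between_induced G (S : {set T}) x y p :
  path_between G x y p -> {subset p <= S} -> path_between (induced G S) x y p.
Proof.
move=> /and3P[/and4P[p0 up /allP pV sp] hp lp] pS.
rewrite /path_between hp lp /is_path p0 up /= andbT; apply/andP; split.
  by apply/allP => z zp; rewrite /= !inE pS // andbT; apply: pV.
apply: (sub_in_sorted (P := mem S)) sp; last by apply/allP.
by move=> z t zS tS zt; rewrite adj_induced zt zS.
Qed.

Lemma is_cycle_induced G (S : {set T}) p :
  is_cycle G p -> {subset p <= S} -> is_cycle (induced G S) p.
Proof.
move=> /and3P[sp up cp] pS; rewrite /is_cycle sp up /=.
apply: (sub_in_cycle (P := mem S)) cp; last by apply/allP.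
by move=> z t zS tS zt; rewrite adj_induced zt zS.
Qed.

Lemma cycle_vset G p : cycle (adj G) p -> {subset p <= vset G}.
Proof.
move=> cp x xp; apply: adj_vset (next_cycle cp xp).
Qed.

Lemma sorted_connect (e : rel T) p :
  symmetric e -> sorted e p -> {in p &, forall x y, connect e x y}.
Proof.
move=> es; case: p => [|a p] //= ap.
have ax x : x \in a :: p -> connect e a x.
  move=> xp; case/splitPl: p / xp ap => p1 p2 <-; rewrite cat_path => /andP[ap _].
  by apply/connectP; exists p1.
move=> x y xp yp; apply: connect_trans (ax y yp).
by rewrite (sym_connect_sym es); apply: ax.
Qed.

(** What a spanning cycle leaves after the deletion of at most one vertex is still traced by a path:
    the cycle is rotated to start at the deleted vertex. *)
Lemma hamiltonian_2connected H p :
  is_cycle H p -> p =i vset H -> k_connected 2 H.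
Proof.
move=> /and3P[sp up cp] pV.
have cV : #|vset H| = size p by rewrite -(card_uniqP up); apply: eq_card => x; rewrite pV.
split=> [|S SV]; first by rewrite cV.
have conn q : q != [::] -> sorted (adj H) q -> q =i vset H :\: S ->
    gconnected (gdelete H S).
  move=> q0 sq qS.
  have VS : vset (gdelete H S) =i q by move=> x; rewrite qS !inE andbC.
  split.
    by case: q q0 VS {sq qS} => // a q _ /(_ a); rewrite mem_head => aV;
       apply/set0Pn; exists a.
  move=> x y; rewrite !VS; apply: sorted_connect; first exact: adj_sym.
  apply: (sub_in_sorted (P := mem q)) sq; last by apply/allP.
  move=> z t /=; rewrite !qS !inE => /andP[zS _] /andP[tS _] zt.
  by rewrite adj_induced zt !inE zS.
have [S0|[z zS] S1] := set_0Vmem S.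
  move=> _; apply: (conn p); first by case: p sp {up cp pV cV}.
    by case: p cp {sp up pV cV} => //= a p; rewrite rcons_path => /andP[].
  by move=> x; rewrite S0 setD0 pV.
have SE : S = [set z].
  by apply/esym/eqP; rewrite eqEcard sub1set zS cards1; lia.
have zp : z \in p by rewrite pV (subsetP SV).
have [i q rp] := rot_to zp.
have uq : uniq (z :: q) by rewrite -rp rot_uniq.
apply: (conn q).
- by have := size_rot i p; rewrite rp; case: (q) => //= E; lia.
- have := cp; rewrite -(rot_cycle i) rp /= rcons_path => /andP[+ _].
  exact: path_sorted.
move=> x; rewrite SE !inE -pV -(mem_rot i p) rp inE.
by case: eqVneq => [->|_] //=; case/andP: uq => /negbTE.
Qed.
End Induced.

(** * Disjoint segments along a cycle *)

Section Segments.
Variable T : finType.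
Implicit Types (G : graph T) (c s : seq T) (X : {set T}) (w q : T -> seq T).

(** The first entry of [w] occurs only once in [s ++ t], and not in [s], so the occurrence of [w]
    starts after [s]. *)
Lemma infix_catr_disjoint (s t w : seq T) :
  uniq (s ++ t) -> w != [::] -> [disjoint w & s] -> infix w (s ++ t) -> infix w t.
Proof.
case: w => // a w ust _ dws /infixP[s1 [s2 E]].
have as_ : a \notin s by move: dws; rewrite disjoint_cons => /andP[].
have as1 : a \notin s1.
  by move: ust; rewrite E cat_uniq => /and3P[_ + _] /=; rewrite negb_or => /andP[].
have le_s : size s <= size s1.
  have := congr1 (index a) E.
  rewrite /= !index_cat (negPf as_) (negPf as1) /= eqxx addn0 => <-.
  exact: leq_addr.
have := congr1 (drop (size s)) E; rewrite (drop_size_cat t (erefl (size s))) => ->.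
rewrite drop_cat; case: ltnP => [lt|ge].
  by apply/infixP; exists (drop (size s) s1), s2.
have -> : size s - size s1 = 0 by lia.
by rewrite drop0; apply: prefix_infix.
Qed.

(** [s] lists [X] in the order in which the segments occur, [q x] is the gap after the segment of
    [x], and [q0] the gap before the first one. The induction removes from the front of [c] either a
    whole segment with its end or a single vertex of a gap. *)
Lemma segment_decomposition c X w :
  uniq c ->
  (forall x, x \in X -> w x != [::] /\ infix (w x) c) ->
  (forall x y z, x \in X -> y \in X -> z \in w x -> z \in w y -> x = y) ->
  exists s q (q0 : seq T), [/\ uniq s, s =i X & c = q0 ++ flatten [seq w x ++ q x | x <- s]].
Proof.
have [n] := ubnP (size c); elim: n c X => // n IHn c X le_cn uc wc wX.
case: c => [|a c] in le_cn uc wc *.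
  exists [::], (fun=> [::]), [::]; split=> // x.
  rewrite in_nil; apply/esym/negP => /wc[]; rewrite infixs0 => /negP.
  by [].
case: (boolP [exists x in X, a \in w x]) => [/exists_inP[x xX ax]|].
  have [wx0 /infixP[s1 [s2 E]]] := wc x xX.
  case: s1 => [|b s1] /= in E; last first.
    by case: E => _ cE; move: uc; rewrite /= cE !mem_cat ax orbT.
  have sz : size s2 < n.
    have := congr1 size E; rewrite size_cat /=.
    by case: (w x) wx0 => //= ? ? _ ; move: le_cn => /=; lia.
  rewrite E in uc.
  have us2 : uniq s2 by move: uc; rewrite cat_uniq => /and3P[].
  have [||s [q [q0 [us sX s2E]]]] := IHn s2 (X :\ x) sz us2.
  - move=> y; rewrite !inE => /andP[yx yX]; have [wy0 wyc] := wc y yX.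
    split=> //; apply: infix_catr_disjoint uc wy0 _ _; last by rewrite -E.
    apply/pred0P => z /=; apply/negP => /andP[zy zx].
    by rewrite (wX y x z) ?eqxx in yx.
  - move=> y y' z; rewrite !inE => /andP[_ yX] /andP[_ y'X].
    exact: wX.
  have xs : x \notin s by rewrite sX !inE eqxx.
  exists (x :: s), (fun y => if y == x then q0 else q y), [::]; split.
  - by rewrite /= xs.
  - by move=> y; rewrite inE sX !inE; case: eqVneq => [->|//]; rewrite xX.
  rewrite /= eqxx E {1}s2E catA; congr (_ ++ flatten _).
  by apply/eq_in_map => y ys; case: eqVneq => // yx; rewrite -yx ys in xs.
rewrite negb_exists_in => /forall_inP aX.
have [||s [q [q0 [us sX E]]]] := IHn c X le_cn (proj2 (andP uc)).
- move=> x xX; have [wx0 wxc] := wc x xX; split=> //.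
  apply: (infix_catr_disjoint (s := [:: a])) => //.
  by apply/pred0P => z /=; rewrite inE; case: eqVneq => [->|]; rewrite ?andbF // (negPf (aX x xX)).
- exact: wX.
by exists s, q, (a :: q0); rewrite E.
Qed.

(** Rotation moves the initial gap [q0] to the end, where it prolongs the gap after the last
    segment. *)
Lemma cyclic_segment_decomposition c X w :
  uniq c -> X != set0 ->
  (forall x, x \in X -> w x != [::] /\ infix (w x) c) ->
  (forall x y z, x \in X -> y \in X -> z \in w x -> z \in w y -> x = y) ->
  exists s q, [/\ uniq s, s =i X
    & exists i, rot i c = flatten [seq w x ++ q x | x <- s]].
Proof.
move=> uc X0 wc wX; have [s [q [q0 [us sX E]]]] := segment_decomposition uc wc wX.
case/lastP: s us sX E => [|s y] us sX E.
  by case/set0Pn: X0 => x; rewrite -sX.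
exists (rcons s y), (fun x => if x == y then q y ++ q0 else q x); split=> //.
exists (size q0); rewrite E rot_size_cat -cats1 !map_cat !flatten_cat /= eqxx.
rewrite !cats0 -!catA; congr (flatten _ ++ _).
apply/eq_in_map => x xs; case: eqVneq => // xy.
by move: us; rewrite rcons_uniq -xy xs.
Qed.

Lemma uniq_flatten_map_inj (g : T -> seq T) s x y z :
  uniq (flatten (map g s)) -> x \in s -> y \in s -> z \in g x -> z \in g y ->
  x = y.
Proof.
elim: s => //= a s IHs; rewrite cat_uniq => /and3P[_ /hasPn nas us].
have ga t : t \in s -> z \in g t -> z \notin g a.
  by move=> ts zt; apply: nas; apply/flatten_mapP; exists t.
rewrite !inE => /orP[/eqP->|xs] /orP[/eqP->|ys] // zx zy.
- by have := ga y ys zy; rewrite zx.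
- by have := ga x xs zx; rewrite zy.
exact: IHs.
Qed.

Lemma uniq_flatten_map_uniq (g : T -> seq T) s x :
  uniq (flatten (map g s)) -> x \in s -> uniq (g x).
Proof.
elim: s => //= a s IHs; rewrite cat_uniq inE => /and3P[ua _ us].
by case/orP=> [/eqP-> //|]; apply: IHs.
Qed.

(** Here [q] is the gap after the segment from [a] to [b], and [r] starts with the next segment; if
    [r] is empty, the gap leads back to [a]. *)
Lemma cycle_next_segment (e : rel T) (a b : T) (w q r : seq T) :
  cycle e ((a :: rcons w b) ++ q ++ r) -> path e b (rcons q (head a r)).
Proof.
rewrite /= rcons_cat cat_path last_rcons => /andP[_].
rewrite rcons_cat cat_path [path e b (rcons q _)]rcons_path => /andP[-> /=].
by case: r => [|c r] /= /andP[].
Qed.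

(** The default of [head] matters when [s] has one entry, which is then its own cyclic successor. *)
Lemma rot_nth_ordS (x0 : T) s (i : 'I_(size s)) :
  exists s', rot i s = nth x0 s i :: s' /\
    head (nth x0 s i) s' = nth x0 s (ordS i).
Proof.
exists (drop i.+1 s ++ take i s); split.
  by rewrite /rot (drop_nth x0 (ltn_ord i)).
rewrite -nth0 nth_cat size_drop nth_drop addn0 /=.
have := ltn_ord i; rewrite leq_eqVlt => /orP[/eqP E|lt].
  rewrite E subnn modnn /=; case: (posnP (val i)) => [i0|i0].
    by rewrite [nat_of_ord i]i0 take0 nth_nil.
  by rewrite nth_take // (set_nth_default x0) //; lia.
by rewrite subn_gt0 lt modn_small // (set_nth_default x0).
Qed.

End Segments.


(** * Criteria for being good *)

Section Good.
Variable T : finType.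
Implicit Types (G : graph T) (c s : seq T) (X : {set T}) (Z : T -> {set T}).

(** Disjointness in the form in which it is applied: a common vertex identifies the two indices. *)
Definition separated X Z : Prop :=
  forall x y z, x \in X -> y \in X -> z \in Z x -> z \in Z y -> x = y.

(** The sequences [a], [m], [b] are the joining paths of length 2; they are disjoint because each
    stays in the set [Z x] of its own [x]. *)
Lemma k_close_good G p c k X Z :
  is_path G p -> is_cycle G c -> [disjoint p & c] -> k <= #|X| ->
  separated X Z ->
  (forall x, x \in X -> exists a m b,
     [/\ a \in p, b \in c, (m \notin p) && (m \notin c),
         adj G a m && adj G m b & {subset [:: a; m; b] <= Z x}]) ->
  k_good k G.
Proof.
move=> pp cc dpc kX sXZ XP; apply: Or33; exists p, c; split=> //.
have cE z : (z \in vset (cycle_graph c)) = (z \in c).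
  rewrite inE mem_cat; case: (c) => //= a r; rewrite take0 !inE.
  by case: eqVneq; rewrite ?orbF.
split.
  apply/pred0P => z /=; rewrite cE mem_path_graph.
  by have /pred0P/(_ z) := dpc.
pose linked x r := [/\ set_path G (vset (path_graph p)) (vset (cycle_graph c)) r,
  plength r <= 2 & {subset r <= Z x}].
have [|R RP] := @finite_choice _ _ [::] linked X.
  move=> x /XP[a [m [b [ap bc /andP[mp mc] /andP[am mb] sZ]]]].
  exists [:: a; m; b]; split=> //; apply/andP; split.
    apply/exists_inP; exists a; first by rewrite mem_path_graph.
    apply/exists_inP; exists b; first by rewrite cE.
    have ab : a != b.
      by apply: contraTneq ap => ->; have /pred0P/(_ b)/= := dpc; rewrite bc andbT => ->.
    rewrite (path_between_cons_rcons _ a [:: m] b).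
    by rewrite /= am mb !inE negb_or (adj_neq am) (adj_neq mb) ab.
  apply/pred0P => z /=; rewrite !inE.
  case: eqVneq => //= ->; rewrite (negPf mp) /=.
  by have := cE m; rewrite inE (negPf mc) => ->.
have ev (i : 'I_k) : i < #|X| by apply: leq_trans kX.
(* The first [k] elements of [X] serve as indices of the [k] paths. *)
pose g (i : 'I_k) : T := enum_val (Ordinal (ev i)).
have gX i : g i \in X by apply: enum_valP.
exists (fun i => R (g i)); split=> [i|i|i j ij].
- by case: (RP _ (gX i)).
- by case: (RP _ (gX i)).
apply/pred0P => z /=; apply/negP; rewrite !inE => /andP[zi zj].
have [_ _ /(_ z zi) Zi] := RP _ (gX i); have [_ _ /(_ z zj) Zj] := RP _ (gX j).
have /enum_val_inj/(congr1 val)/= E := sXZ _ _ _ (gX i) (gX j) Zi Zj.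
by move/eqP: ij; apply; apply: val_inj.
Qed.

Lemma gbigunion_wf (I : finType) (H : I -> graph T) :
  [forall e in \bigcup_i eset (H i),
     (#|e| == 2) && (e \subset \bigcup_i vset (H i))].
Proof.
apply/forall_inP => e /bigcupP[i _ ei].
have /forall_inP/(_ e ei)/andP[-> /= eV] := graph_wf (H i).
exact: subset_trans eV (bigcup_sup i _).
Qed.
Definition gbigunion (I : finType) (H : I -> graph T) : graph T :=
  Graph (gbigunion_wf H).

Lemma gbigunion_subgraph (I : finType) (H : I -> graph T) i :
  subgraph (H i) (gbigunion H).
Proof. by split; apply: bigcup_sup. Qed.

Lemma subgraph_trans G1 G2 G3 :
  subgraph G1 G2 -> subgraph G2 G3 -> subgraph G1 G3.
Proof. by move=> [v12 e12] [v23 e23]; split; apply: subset_trans; eassumption. Qed.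

(** [w] is meant to be a segment of a long cycle and [E] a list of vertices off that cycle. The
    block on [w ++ E] is 2-connected thanks to [h], and the necklace enters and leaves it at the
    ends [a] and [b] of [w]. *)
Definition wiggle G (w E : seq T) : Prop := exists a w' b h p q,
  [/\ w = a :: rcons w' b, is_cycle G h, h =i w ++ E,
      [/\ path_between G a b p, path_between G a b q,
          {subset p <= w ++ E} & {subset q <= w ++ E}]
    & plength q = plength p + 1 \/ plength q = plength p + 2].

(** Each segment [w x] of the cycle is thickened to a block by [E x], and the gaps between
    consecutive segments become the connecting paths of the necklace. As [k] is positive, there is
    at least one block. *)
Lemma wiggly_necklace_good G c k X Z (w E : T -> seq T) :
  is_cycle G c -> k <= #|X| -> 0 < k -> separated X Z ->
  (forall x, x \in X ->
     [/\ wiggle G (w x) (E x), infix (w x) c, {subset w x ++ E x <= Z x}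
       & [disjoint E x & c]]) ->
  k_good k G.
Proof.
move=> /and3P[_ uc cc] kX k0 sXZ XP.
have [x0 x0X] : exists x0, x0 \in X by apply/set0Pn; rewrite -card_gt0; lia.
have X0 : X != set0 by apply/set0Pn; exists x0.
have [||s [q [us sX [r rE]]]] := @cyclic_segment_decomposition _ c X w uc X0.
- by move=> x /XP[[a [w' [b [h [p [q [-> _ _ _ _]]]]]]] wc _ _].
- move=> x y z xX yX zx zy; apply: (sXZ x y z) => //.
    by have [_ _ sZ _] := XP x xX; apply: sZ; rewrite mem_cat zx.
  by have [_ _ sZ _] := XP y yX; apply: sZ; rewrite mem_cat zy.
(* Up to rotation, [c] is the concatenation of the pieces [g x]. *)
pose g x := w x ++ q x.
have uf : uniq (flatten (map g s)) by rewrite -rE rot_uniq.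
have cf : cycle (adj G) (flatten (map g s)) by rewrite -rE rot_cycle.
have memc x z : x \in s -> z \in g x -> z \in c.
  by move=> xs zx; rewrite -(mem_rot r) rE; apply/flatten_mapP; exists x.
have ug x : x \in s -> uniq (g x) by apply: uniq_flatten_map_uniq uf.
have ginj x y z : x \in s -> y \in s -> z \in g x -> z \in g y -> x = y.
  exact: uniq_flatten_map_inj uf.
have Ec x z : x \in s -> z \in E x -> z \notin c.
  rewrite sX => /XP[_ _ _ /pred0P/(_ z)/= + zE].
  by rewrite zE /= => ->.
pose n := size s.
pose f (i : 'I_n) := nth x0 s i.
have fs i : f i \in s by apply: mem_nth.
have f_inj i j : f i = f j -> i = j.
  by move/eqP; rewrite nth_uniq // => /eqP/val_inj.
pose hd x := head x (w x).
pose lt x := last x (w x).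
have hdw x : x \in s -> hd x \in w x.
  rewrite sX => /XP[[a [w' [b [h [p [q' [wE _ _ _ _]]]]]]] _ _ _].
  by rewrite /hd wE mem_head.
have ltw x : x \in s -> lt x \in w x.
  rewrite sX => /XP[[a [w' [b [h [p [q' [wE _ _ _ _]]]]]]] _ _ _].
  by rewrite /lt wE /= mem_last.
pose B i := induced G [set z in w (f i) ++ E (f i)].
(* The gap is completed by its two neighbours on the cycle. An empty gap gives an edge, and with a
   single block the path returns to that same block. *)
pose Q i := lt (f i) :: rcons (q (f i)) (hd (f (ordS i))).
have wg x z : z \in w x -> z \in g x by rewrite mem_cat => ->.
have qg x z : z \in q x -> z \in g x by rewrite mem_cat orbC => ->.
have wq x z : x \in s -> z \in w x -> z \in q x -> False.
  move=> xs zw zq; have := ug x xs; rewrite cat_uniq => /and3P[_ /hasPn/(_ z zq)].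
  by rewrite /= zw.
have hdlt x : x \in s -> hd x != lt x.
  move=> xs; have := ug x xs; rewrite cat_uniq => /and3P[+ _ _]; move: xs.
  rewrite sX /hd /lt => /XP[[a [w' [b [h [p [q' [-> _ _ _ _]]]]]]] _ _ _] /=.
  by rewrite last_rcons mem_rcons inE negb_or => /andP[/andP[]].
have uQ i : uniq (Q i).
  have := ug _ (fs i); rewrite cat_uniq => /and3P[uw _ uq].
  rewrite /Q /= mem_rcons inE negb_or rcons_uniq uq andbT -andbA; apply/and3P; split.
  - apply/eqP => lh; have E1 : f i = f (ordS i).
      apply: ginj (fs _) (fs _) (wg _ _ (ltw _ (fs _))) _.
      by rewrite lh; apply/wg/hdw.
    by have := hdlt _ (fs i); rewrite {1}E1 lh eqxx.
  - by apply/negP; apply: wq (fs i) (ltw _ (fs i)).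
  apply/negP => hq; have E1 : f i = f (ordS i).
    by apply: ginj (fs _) (fs _) (qg _ _ hq) _; apply/wg/hdw.
  by apply: (wq _ (hd (f (ordS i))) (fs i)) => //; rewrite E1; apply: hdw.
have pQ i : path (adj G) (lt (f i)) (rcons (q (f i)) (hd (f (ordS i)))).
  have [s' [rs hs']] := rot_nth_ordS x0 i.
  have : cycle (adj G) (g (f i) ++ flatten (map g s')).
    have -> : g (f i) ++ flatten (map g s') = flatten (map g (rot i s)) by rewrite rs.
    rewrite /rot map_cat flatten_cat cycle_catC -flatten_cat -map_cat cat_take_drop.
    exact: cf.
  (* With a single segment [s'] is empty, and the default [hd (f i)] is the correct end. *)
  have hdE : head (hd (f i)) (flatten (map g s')) = hd (f (ordS i)).
    rewrite /f -hs' -/(f i); case: s' rs {hs'} => //= y s' rs.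
    have ys : y \in s by rewrite -(mem_rot i) rs !inE eqxx orbT.
    move: ys; rewrite sX /hd /g => /XP[[a [w' [b [h [p [q' [-> _ _ _ _]]]]]]] _ _ _] //.
  move: hdE; have := fs i; rewrite sX /g /hd /lt.
  move=> /XP[[a [w' [b [h [p [q' [-> _ _ _ _]]]]]]] _ _ _].
  rewrite -catA /= last_rcons => <-.
  exact: cycle_next_segment.
have bQ i : path_between G (lt (f i)) (hd (f (ordS i))) (Q i).
  by rewrite path_between_cons_rcons pQ; apply: uQ.
pose N := gbigunion (fun i => gunion (B i) (path_graph (Q i))).
have BN i : subgraph (B i) N.
  apply: subgraph_trans (gbigunion_subgraph _ i).
  by split; apply: subsetUl.
have QN i : subgraph (path_graph (Q i)) N.
  apply: subgraph_trans (gbigunion_subgraph _ i).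
  by split; apply: subsetUr.
have QG i : subgraph (path_graph (Q i)) G.
  by case/and3P: (bQ i) => /and4P[_ _ ? ?] _ _; apply: path_graph_subgraph.
apply: Or32; exists N.
  split; apply/bigcupsP => i _; rewrite subUset; have [? ?] := QG i.
    by have [-> _] := induced_subgraph G [set z in w (f i) ++ E (f i)].
  by have [_ ->] := induced_subgraph G [set z in w (f i) ++ E (f i)].
have BV i z : (z \in vset (B i)) = (z \in w (f i)) || (z \in E (f i)).
  rewrite !inE mem_cat andb_idl // => zi.
  have := fs i; rewrite sX => /XP[[a [w' [b [h [p [q' [_ hc hE _ _]]]]]]] _ _ _].
  apply: cycle_vset (proj2 (andP (proj2 (andP hc)))) _ _.
  by rewrite hE mem_cat.
have VB i z : z \in vset (B i) -> z \in c -> z \in w (f i).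
  by rewrite BV => /orP[//|zE] zc; have := Ec _ _ (fs i) zE; rewrite zc.
have Qin i z : z \in Q i -> [\/ z = lt (f i), z \in q (f i) | z = hd (f (ordS i))].
  rewrite inE mem_rcons inE => /or3P[/eqP|/eqP|]; first exact: Or31.
    exact: Or33.
  exact: Or32.
have Qc i z : z \in Q i -> z \in c.
  by case/Qin => [->|zq|->]; [apply/(memc (f i))/wg/ltw|apply/(memc (f i))/qg
    |apply/(memc (f (ordS i)))/wg/hdw].
have intQ i j : [disjoint interior (Q i) & vset (B j)].
  rewrite interior_cons_rcons; apply/pred0P => z /=; apply/negP => /andP[zq zB].
  have zw := VB _ _ zB (memc _ _ (fs i) (qg _ _ zq)).
  have E1 := ginj _ _ _ (fs i) (fs j) (qg _ _ zq) (wg _ _ zw).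
  by apply: (wq (f j) z (fs j)) => //; rewrite -E1.
exists n, B, Q, (fun i => hd (f i)), (fun i => lt (f i)); split.
- split.
  + by rewrite /n lt0n size_eq0; apply: contraTneq x0X => s0; rewrite -sX s0.
  + by split.
  + split=> [i|i j ij].
      have := fs i; rewrite sX => /XP[[a [w' [b [h [p [q' [_ hc hE _ _]]]]]]] _ _ _].
      apply: (@hamiltonian_2connected _ _ h) => [|z].
        by apply: is_cycle_induced => // z; rewrite hE inE.
      by rewrite BV hE mem_cat.
    apply/pred0P => z /=; apply/negP => /andP[zi zj]; case/negP: ij; apply/eqP/f_inj.
    have fX l : f l \in X by rewrite -sX.
    apply: (sXZ _ _ z) => //.
      by have [_ _ sZ _] := XP _ (fX i); apply: sZ; rewrite mem_cat -BV.
    by have [_ _ sZ _] := XP _ (fX j); apply: sZ; rewrite mem_cat -BV.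
  split=> [i|i j ij|//].
    apply/andP; split.
      apply/exists_inP; exists (lt (f i)); first by rewrite BV ltw.
      apply/exists_inP; exists (hd (f (ordS i))); first by rewrite BV hdw.
      rewrite path_between_cons_rcons uQ andbT.
      have [_ /subsetP sE] := QN i.
      apply: sub_path (path_graph_sorted (uQ i)) => y z.
      exact: sE.
    apply/pred0P => z /=; rewrite in_setU andb_orr.
    by have /pred0P/(_ z)/= -> := intQ i i; have /pred0P/(_ z)/= -> := intQ i (ordS i).
  (* The vertex [hd (f l)] is the end of the path arriving at block [l] and is not on the path
     leaving it. So a vertex common to two paths is either interior to one piece [g] for both or
     such an end for both, and the indices agree, in the latter case by injectivity of [ordS]. *)
  have QP l z : z \in Q l -> (z \in g (f l) /\ z != hd (f l)) \/ z = hd (f (ordS l)).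
    case/Qin=> [->|zq|->]; last by right.
      by left; rewrite eq_sym hdlt //; split=> //; apply/wg/ltw.
    left; split; first exact: qg.
    by apply/eqP => zh; apply: (wq (f l) z) => //; rewrite zh; apply: hdw.
  have clash l m z : z \in g (f l) -> z != hd (f l) -> z = hd (f (ordS m)) -> False.
    move=> zl /eqP znh zh; apply: znh; rewrite zh; congr hd; apply/esym.
    by apply: ginj (fs _) (fs _) zl _; rewrite zh; apply/wg/hdw.
  apply/pred0P => z /=; apply/negP; rewrite !inE => /andP[zi zj].
  case/negP: ij; apply/eqP; case/QP: zi => [[zi zhi]|zhi]; case/QP: zj => [[zj zhj]|zhj].
  + exact: f_inj (ginj _ _ _ (fs i) (fs j) zi zj).
  + by case: (clash i j z).
  + by case: (clash j i z).
  apply: (can_inj (@ordSK _)); apply: f_inj.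
  by apply: (ginj _ _ z) => //; [rewrite zhi|rewrite zhj]; apply/wg/hdw.
- move=> i; split; first exact: hdlt.
  apply/setP => z; rewrite inE in_set2; apply/andP/orP.
    move=> [zB /existsP[j zj]]; have zw := VB _ _ zB (Qc _ _ zj).
    case/Qin: zj => [zE|zq|zE].
    + right; rewrite zE; apply/eqP; congr lt; apply/esym.
      by apply: ginj (fs i) (fs j) (wg _ _ zw) _; rewrite zE; apply/wg/ltw.
    + have E1 := ginj _ _ _ (fs i) (fs j) (wg _ _ zw) (qg _ _ zq).
      by case: (wq (f j) z (fs j)) => //; rewrite -E1.
    left; rewrite zE; apply/eqP; congr hd; apply/esym.
    by apply: ginj (fs i) (fs _) (wg _ _ zw) _; rewrite zE; apply/wg/hdw.
  case=> /eqP->; rewrite BV ?hdw ?ltw //; split=> //; apply/existsP.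
    (* The entry vertex of block [i] lies on the path of the preceding index, its exit vertex on the
       path of [i] itself. *)
    exists (ord_pred i); rewrite /Q inE mem_rcons ord_predK inE eqxx orbT.
    by [].
  by exists i; rewrite mem_head.
exists [set: 'I_n] => [|i _].
  rewrite cardsT card_ord /n; have <- : #|X| = size s; last by [].
  by rewrite -(card_uniqP us); apply: eq_card => z; rewrite sX.
have := fs i; rewrite sX => fX.
have [[a [w' [b [h [p [q' [wE _ _ [pp pq sp sq] pl]]]]]]] _ _ _] := XP _ fX.
exists p, q'; split=> //; rewrite /hd /lt wE /= last_rcons.
  by apply: path_between_induced pp _ => z; rewrite inE => /sp.
by apply: path_between_induced pq _ => z; rewrite inE => /sq.
Qed.

End Good.


(** * Theta-graphs and their shortest legs *)

Section Legs.
Variable T : finType.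
Implicit Types (G : graph T) (t : 'I_3 -> seq T).

(* A theta-graph is handled through the interiors t of its three legs. *)
Definition leg u v t i : seq T := u :: rcons (t i) v.

(** Nonempty disjoint interiors are distinct anyway, so [injective t] says that at most one leg is a
    single edge. *)
Definition theta_legs G u v t : Prop :=
  [/\ u != v, forall i, path_between G u v (leg u v t i),
      forall i j z, z \in t i -> z \in t j -> i = j & injective t].

Definition legs_graph u v t : graph T :=
  theta_graph (leg u v t ord0) (leg u v t (@Ordinal 3 1 isT))
              (leg u v t (@Ordinal 3 2 isT)).

Definition legs_set u v t : {set T} :=
  [set z | [|| z == u, z == v | [exists i, z \in t i]]].

Lemma ord3P (i : 'I_3) :
  [\/ i = ord0, i = @Ordinal 3 1 isT | i = @Ordinal 3 2 isT].
Proof.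
case: i => [[|[|[|//]]] lt_i]; [apply: Or31|apply: Or32|apply: Or33]; exact: val_inj.
Qed.

Lemma mem_leg u v t i z : (z \in leg u v t i) = [|| z == u, z == v | z \in t i].
Proof. by rewrite inE mem_rcons inE. Qed.

Lemma legs_setP u v t z : reflect [\/ z = u, z = v | exists i, z \in t i]
                                  (z \in legs_set u v t).
Proof.
rewrite inE; apply: (iffP or3P) => [[/eqP|/eqP|/existsP]|[/eqP|/eqP|/existsP]];
  by [apply: Or31|apply: Or32|apply: Or33].
Qed.

Lemma leg_sub_legs_set u v t i z : z \in leg u v t i -> z \in legs_set u v t.
Proof.
rewrite mem_leg => /or3P[/eqP zu|/eqP zv|zi]; apply/legs_setP; [exact: Or31|exact: Or32|].
by apply: Or33; exists i.
Qed.

Lemma vset_legs_graph u v t : vset (legs_graph u v t) = legs_set u v t.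
Proof.
apply/setP => z; rewrite !in_setU !mem_path_graph !mem_leg.
apply/idP/legs_setP => [/or3P[]/or3P[/eqP|/eqP|]|[->|->|[i]]].
all: rewrite ?eqxx ?orbT //; try by move=> ?; apply: Or31.
all: try by move=> ?; apply: Or32.
all: try by move=> ?; apply: Or33; eexists; eassumption.
by case: (ord3P i) => -> ->; rewrite ?orbT.
Qed.

Lemma eset_legs_graph u v t :
  eset (legs_graph u v t) = \bigcup_i eset (path_graph (leg u v t i)).
Proof.
apply/setP => e; rewrite !in_setU; apply/idP/bigcupP => [/or3P[]|[i _]].
- by exists ord0.
- by exists (@Ordinal 3 1 isT).
- by exists (@Ordinal 3 2 isT).
by case: (ord3P i) => -> ->; rewrite ?orbT.
Qed.

Lemma is_theta_legs G u v p1 p2 p3 : is_theta G u v p1 p2 p3 ->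
  exists t, [/\ theta_legs G u v t, p1 = leg u v t ord0,
    p2 = leg u v t (@Ordinal 3 1 isT) & p3 = leg u v t (@Ordinal 3 2 isT)].
Proof.
move=> [uv [b1 b2 b3] + [d12 d13 d23]] /=.
rewrite /= !inE negb_or andbT => /andP[/andP[/eqP n12 /eqP n13] /eqP n23].
have [[E1 E2] E3] := (path_between_interior uv b1, path_between_interior uv b2,
  path_between_interior uv b3).
exists (fun i => nth [::] [:: interior p1; interior p2; interior p3] i).
split=> //; split=> // [i|i j z|i j].
- by case: (ord3P i) => ->; rewrite /leg /= -?E1 -?E2 -?E3.
- move: d12 d13 d23 => /pred0P/(_ z)/= d12 /pred0P/(_ z)/= d13 /pred0P/(_ z)/= d23.
  case: (ord3P i) => ->; case: (ord3P j) => -> //= z1 z2;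
  by move: d12 d13 d23; rewrite z1 z2.
case: (ord3P i) => ->; case: (ord3P j) => -> //= EI; exfalso.
all: by [apply: n12; rewrite E1 E2 EI|apply: n13; rewrite E1 E3 EI
        |apply: n23; rewrite E2 E3 EI].
Qed.

Lemma theta_legs_is_theta G u v t : theta_legs G u v t ->
  is_theta G u v (leg u v t ord0) (leg u v t (@Ordinal 3 1 isT))
    (leg u v t (@Ordinal 3 2 isT)).
Proof.
move=> [uv bt dt it].
have inj i j : leg u v t i = leg u v t j -> i = j.
  by move=> E; apply: it; rewrite -(interior_cons_rcons u (t i) v) [_ :: _]E interior_cons_rcons.
have disj i j : i != j -> [disjoint interior (leg u v t i) & interior (leg u v t j)].
  move=> ij; rewrite !interior_cons_rcons; apply/pred0P => z /=.
  by apply/negP => /andP[zi zj]; rewrite (dt i j z) ?eqxx in ij.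
split=> //; last by split; apply: disj.
rewrite /= !inE negb_or andbT; apply/andP; split; first apply/andP; try split.
all: by apply/eqP => /inj/(congr1 val).
Qed.

Definition short_legs G u v t : Prop :=
  theta_legs G u v t /\ forall t', theta_legs G u v t' ->
    #|eset (legs_graph u v t)| <= #|eset (legs_graph u v t')|.

Lemma short_theta_legs G p1 p2 p3 : short_theta G p1 p2 p3 ->
  exists u v t, short_legs G u v t /\ theta_graph p1 p2 p3 = legs_graph u v t.
Proof.
move=> [u [v [th min]]]; have [t [tt E1 E2 E3]] := is_theta_legs th.
exists u, v, t; split; last by rewrite E1 E2 E3.
split=> // t' /theta_legs_is_theta/min; by rewrite E1 E2 E3.
Qed.

Section Theta.
Variables (G : graph T) (u v : T) (t : 'I_3 -> seq T).
Hypothesis tt : theta_legs G u v t.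

Lemma legs_uniq i : uniq (leg u v t i).
Proof. by have [_ /(_ i)/and3P[/and4P[]]] := tt. Qed.

Lemma legs_path i : path (adj G) u (rcons (t i) v).
Proof. by have [_ /(_ i)/and3P[/and4P[]]] := tt. Qed.

Lemma end_notin_leg i : (u \notin t i) && (v \notin t i).
Proof.
have := legs_uniq i; rewrite /leg /= mem_rcons inE negb_or rcons_uniq.
by case/andP=> /andP[_ ->] /andP[->].
Qed.

Lemma leg_in_legs_set i z : z \in t i -> z \in legs_set u v t.
Proof. by move=> zi; apply/legs_setP/Or33; exists i. Qed.

(** Two legs share only [u] and [v], so a common edge would be [uv]. A leg containing that edge has
    empty interior, which cannot happen for two legs. *)
Lemma disjoint_eset_legs i j : i != j ->
  [disjoint eset (path_graph (leg u v t i)) & eset (path_graph (leg u v t j))].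
Proof.
move=> ij; rewrite disjoint_subset; apply/subsetP => e ei; rewrite inE; apply/negP => ej.
have sE z : z \in e -> z \in [set u; v].
  move=> ze; have := eset_path_graph_sub ei ze; have := eset_path_graph_sub ej ze.
  rewrite !mem_leg !inE => /or3P[->|->|zj] // /or3P[->|->|zi] //; rewrite ?orbT //.
  by have [_ _ /(_ i j z zi zj) E _] := tt; rewrite E eqxx in ij.
have [uv _ _ it] := tt.
have eE : e = [set u; v].
  apply/eqP; rewrite eqEcard; apply/andP; split; first by apply/subsetP.
  have /forall_inP/(_ e ei)/andP[/eqP-> _] := graph_wf (path_graph (leg u v t i)).
  by rewrite cards2 uv.
have nilP l : e \in eset (path_graph (leg u v t l)) -> t l = [::].
  rewrite eE => el; apply/eqP; rewrite -size_eq0; apply/eqP.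
  have /andP[un vn] := end_notin_leg l.
  have := legs_uniq l; rewrite /leg in el *.
  case: (t l) un vn el => [//|a s] un vn el /= /andP[us _].
  have ua : u != a by move: un; rewrite inE negb_or => /andP[].
  move: el; rewrite rcons_cons eset_path_graph_cons // in_setU1 => /orP[/eqP E|].
    have: v \in [set u; a] by rewrite -E !inE eqxx orbT.
    rewrite !inE eq_sym (negPf uv) /= => /eqP va.
    by move: vn; rewrite va mem_head.
  move/eset_path_graph_sub/(_ u); rewrite !inE eqxx => /(_ isT) E.
  by move: us; rewrite inE E.
by move/eqP: ij; apply; apply: it; rewrite !nilP.
Qed.

Lemma degree_ge x (s : seq T) : uniq s -> all (adj G x) s -> size s <= degree G x.
Proof.
move=> us /allP xs; rewrite -(card_uniqP us); apply/subset_leq_card/subsetP => z.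
by rewrite inE; apply: xs.
Qed.

Hypothesis cubG : cubic G.

(** Applied to lists of four distinct neighbours to reach a contradiction. *)
Lemma cubic_degree x (s : seq T) :
  uniq s -> all (adj G x) s -> size s <= 3.
Proof.
move=> us xs; case: s us xs => [//|y s] us xs.
rewrite -(cubG (x := x)); first exact: degree_ge.
by case/andP: xs => /adj_vset.
Qed.

(** The predecessor and the successor of [z] on its leg take up two of its three edges. *)
Lemma inner_off_nbr i z x y : z \in t i ->
  adj G z x -> adj G z y -> x \notin legs_set u v t -> y \notin legs_set u v t ->
  x = y.
Proof.
move=> zi zx zy xn yn; apply/eqP; case: (eqVneq x y) => // nxy.
have := legs_path i; have := legs_uniq i; have lin := @leg_in_legs_set i.
rewrite /leg; case/splitPr: (t i) / zi lin => A C lin.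
rewrite -cats1 -catA cat_path /= => /andP[uAC uniqAC] /and3P[_ Az zC].
have zh : adj G z (head v C) by case: (C) zC => [|c C'] /= /andP[].
have hin : head v C \in C ++ [:: v] by case: (C) => [|c C'] /=; rewrite mem_head.
have hS : head v C \in legs_set u v t.
  move: hin; rewrite mem_cat inE => /orP[hC|/eqP->]; last by apply/legs_setP/Or32.
  by apply: lin; rewrite mem_cat inE hC !orbT.
have lS : last u A \in legs_set u v t.
  have := mem_last u A; rewrite inE => /orP[/eqP->|lA]; first by apply/legs_setP/Or31.
  by apply: lin; rewrite mem_cat lA.
have off a b : a \in legs_set u v t -> b \notin legs_set u v t -> a != b.
  by move=> aS; apply: contraNneq => <-.
suff : size [:: last u A; head v C; x; y] <= 3 by [].
apply: (@cubic_degree z); last by rewrite /= adj_sym Az zh zx zy.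
rewrite /= !inE !negb_or (off _ _ lS xn) (off _ _ lS yn) (off _ _ hS xn) (off _ _ hS yn).
rewrite nxy !andbT.
apply: contraTneq (mem_last u A) => ->; rewrite inE negb_or; apply/andP; split.
  by apply: contraNneq uAC => <-; rewrite mem_cat in_cons hin !orbT.
move: uniqAC; rewrite cat_uniq => /and3P[_ /hasPn nA _]; apply: nA.
by rewrite in_cons hin orbT.
Qed.

(** Stated for an arbitrary [e] to serve both ends of the theta-graph, with [h i] the neighbour of
    [e] on leg [i]. *)
Lemma end_off_nbr e (h : 'I_3 -> T) x :
  injective h -> (forall i, adj G e (h i) /\ h i \in legs_set u v t) ->
  adj G e x -> x \in legs_set u v t.
Proof.
move=> hi hP ex; case: (boolP (x \in _)) => // xn.
have hx i : h i != x by apply: contraNneq xn => <-; case: (hP i).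
have hh i j : i != j -> h i != h j by apply: contra_neq; apply: hi.
suff : size [:: h ord0; h (@Ordinal 3 1 isT); h (@Ordinal 3 2 isT); x] <= 3 by [].
apply: (@cubic_degree e); last by rewrite /= ex !(hP _).1.
by rewrite /= !inE !negb_or !hx !hh.
Qed.

(** The ends [u] and [v] spend all three edges on the legs. *)
Lemma off_nbr_inner z x : z \in legs_set u v t -> adj G z x ->
  x \notin legs_set u v t -> exists i, z \in t i.
Proof.
have [uv _ dt it] := tt; have vn i := proj2 (andP (end_notin_leg i)).
have un i := proj1 (andP (end_notin_leg i)).
case/legs_setP=> [->|->|//] ex /negP[].
  (* For the leg that may be the edge [uv], the default [v] is the neighbour of [u]; the three
     neighbours differ since at most one leg is an edge. *)
  apply: (@end_off_nbr u (fun i => head v (t i))) ex => [i j|i].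
    case Ei: (t i) (vn i) (it i j) (dt i j) => [|a s]; case: (t j) (vn j) => [|b r] //=.
    + by move=> _ _ /(_ erefl).
    + by rewrite inE negb_or => /andP[/eqP].
    + by move=> _; rewrite inE negb_or => /andP[/eqP nva _] _ _ /esym.
    by move=> _ _ _ /(_ a) + E; rewrite -E !mem_head; apply.
  split; first by have := legs_path i; case: (t i) => [|a s] /= /andP[].
  case E : (t i) => [|a s]; first by apply/legs_setP/Or32.
  by apply: (@leg_in_legs_set i); rewrite E mem_head.
apply: (@end_off_nbr v (fun i => last u (t i))) ex => [i j|i].
  case/lastP Ei: (t i) (un i) (it i j) (dt i j) => [|a s]; case/lastP: (t j) (un j) => [|b r] //=.
  + by move=> _ _ /(_ erefl).
  + by rewrite last_rcons mem_rcons inE negb_or => /andP[/eqP].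
  + by move=> _; rewrite last_rcons mem_rcons inE negb_or => /andP[/eqP nva _] _ _ /esym.
  rewrite !last_rcons => _ _ _ /(_ s) + E; rewrite -E !mem_rcons !mem_head; exact.
split; first by rewrite adj_sym; have := legs_path i; rewrite rcons_path => /andP[].
case/lastP E : (t i) => [|a s]; first by apply/legs_setP/Or31.
by apply: (@leg_in_legs_set i); rewrite E last_rcons mem_rcons mem_head.
Qed.

Lemma legs_cycle i j : i != j -> is_cycle G (u :: t i ++ v :: rev (t j)).
Proof.
move=> ij; have [uv _ dt it] := tt.
have vn l := proj2 (andP (end_notin_leg l)); have un l := proj1 (andP (end_notin_leg l)).
have ut l : uniq (t l) by have := legs_uniq l; rewrite /leg /= rcons_uniq => /and3P[].
apply/and3P; split.
(* The cycle has at least three vertices because the two interiors are not both empty. *)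
- rewrite /= size_cat /= size_rev addnS !ltnS addn_gt0 !lt0n !size_eq0 -negb_and.
  by apply: contraNN ij => /andP[/eqP ti /eqP tj]; apply/eqP/it; rewrite ti.
- rewrite /= mem_cat in_cons mem_rev !negb_or !un uv cat_uniq ut /= mem_rev vn rev_uniq ut.
  rewrite (negPf (vn i)) /= andbT; apply/hasPn => z; rewrite mem_rev => zj.
  by apply: contraNN ij => zi; apply/eqP; apply: dt zi zj.
rewrite /= rcons_cat cat_path /=.
have := legs_path i; rewrite rcons_path => /andP[-> ->] /=.
have := rev_path (adj G) u (rcons (t j) v); rewrite last_rcons belast_rcons rev_cons => ->.
by under eq_path => x y do rewrite adj_sym; apply: legs_path.
Qed.

Lemma leg_is_path i : t i != [::] -> is_path G (t i).
Proof.
move=> t0; have := legs_uniq i; have := legs_path i; rewrite /leg => pi ui.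
have ut : uniq (t i) by move: ui; rewrite /= rcons_uniq => /and3P[].
have si : sorted (adj G) (t i) by move: pi; rewrite rcons_path => /andP[/path_sorted].
apply/and4P; split=> //; apply/allP => z zi.
case: (t i) pi zi {ut si ui t0} => // a s /andP[ua as_] zs.
by have /allP := path_all_vset (adj_vsetr ua) as_; move: zs; rewrite inE => /orP[/eqP->|zs];
  [move=> _; apply: adj_vsetr ua|apply; rewrite mem_rcons inE zs orbT].
Qed.

End Theta.

(** Replacing the stretch [M] of leg [i] by the detour [e] gives a theta-graph with the same ends,
    which cannot have fewer edges. *)
Lemma short_leg_exchange G u v t i A C M e a b :
  short_legs G u v t -> t i = A ++ a :: M ++ b :: C ->
  e != [::] -> uniq e -> {in e, forall z, z \notin legs_set u v t} ->
  path (adj G) a (rcons e b) -> size M <= size e.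
Proof.
move=> [tt min] tiE e0 ue eoff aeb; have [uv _ dt it] := tt.
pose ti' := A ++ a :: e ++ b :: C.
pose t' j := if j == i then ti' else t j.
have t'i : t' i = ti' by rewrite /t' eqxx.
have mem' z : z \in ti' -> z \in t i \/ z \in e.
  rewrite tiE !mem_cat !inE !mem_cat !inE => /or4P[->|->|->|/orP[->|->]];
  by rewrite ?orbT; by [left|right].
have tt' : theta_legs G u v t'.
  split=> // [j|j l z|j l].
  - rewrite /leg /t'; case: (eqVneq j i) => [_|ji]; last first.
      by rewrite path_between_cons_rcons legs_path //; apply: legs_uniq tt j.
    rewrite path_between_cons_rcons; apply/andP; split.
      have := legs_path tt i; rewrite tiE /ti' !rcons_cat !cat_path /= !rcons_cat !cat_path /=.
      move=> /and4P[-> -> _ /andP[_ ->]].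
      by move: aeb; rewrite rcons_path => /andP[-> ->].
    (* With the replaced stretch isolated, only the disjointness of [e] from the rest of the leg
       remains to be checked. *)
    have split3 N : u :: rcons (A ++ a :: N ++ b :: C) v =
        (u :: rcons A a) ++ N ++ rcons (b :: C) v.
      by rewrite rcons_cat rcons_cons rcons_cat -cat_rcons.
    have := legs_uniq tt i; rewrite /leg tiE /ti' (split3 M) (split3 e).
    rewrite (uniq_catCA _ M) (uniq_catCA _ e) cat_uniq => /and3P[_ _ uAC].
    rewrite cat_uniq ue uAC andbT andTb; apply/hasPn => z zl.
    apply/negP => /eoff/negP[]; apply: (@leg_sub_legs_set _ _ _ i).
    rewrite /leg tiE split3 !mem_cat; move: zl; rewrite mem_cat.
    by case/orP=> ->; rewrite ?orbT.
  - rewrite /t'; case: (eqVneq j i) => [->|ji]; case: (eqVneq l i) => [->|li] //.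
    + case/mem'=> [|/eoff zn zl]; first exact: dt.
      by case/negP: zn; apply: leg_in_legs_set zl.
    + move=> zl /mem'[|/eoff zn]; first exact: dt.
      by case/negP: zn; apply: leg_in_legs_set zl.
    exact: dt.
  have ne m : m != i -> ti' = t m -> False.
    move=> _ E; have [z ze] : exists z, z \in e.
      by case: (e) e0 => // z s _; exists z; rewrite mem_head.
    have : z \in ti' by rewrite /ti' mem_cat in_cons mem_cat ze !orbT.
    by rewrite E => /(leg_in_legs_set u v); apply/negP/eoff.
  rewrite /t'; case: (eqVneq j i) => [->|ji]; case: (eqVneq l i) => [->|li] //.
  + by move/(ne l li).
  + by move/esym/(ne j ji).
  exact: it.
have split_i s : eset (legs_graph u v s) = eset (path_graph (leg u v s i)) :|:
    \bigcup_(j | j != i) eset (path_graph (leg u v s j)).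
  by rewrite eset_legs_graph (bigD1 i).
have := min t' tt'; rewrite !split_i.
have -> : \bigcup_(j | j != i) eset (path_graph (leg u v t' j)) =
          \bigcup_(j | j != i) eset (path_graph (leg u v t j)).
  by apply: eq_bigr => j ji; rewrite /leg /t' (negPf ji).
(* The edge count must be exact for the old theta-graph, where disjointness of the legs is used; for
   the new one an upper bound suffices. *)
set R := \bigcup_(j | _) _; rewrite (cardsU (eset _)).
have -> : eset (path_graph (leg u v t i)) :&: R = set0.
  apply/setP => f; rewrite in_set0; apply/setIP => -[fi /bigcupP[j ji fj]].
  have := disjoint_eset_legs tt ji; rewrite disjoint_subset => /subsetP/(_ f fj).
  by rewrite inE fi.
rewrite cards0 subn0 => /leq_trans/(_ (leq_card_setU _ _)).
rewrite leq_add2r !card_eset_path_graph ?(legs_uniq tt) ?(legs_uniq tt') //.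
rewrite /leg t'i tiE /ti' /= !size_rcons !size_cat /= !size_cat /=; lia.
Qed.
End Legs.


(** * Rerouting a path through bypasses *)

Section Reroute.
Variables (T : finType) (e : rel T).
Hypothesis e_sym : symmetric e.
Implicit Types (p r : seq T) (S : {set T}).

(** On [p] the vertex [f] can take the place of [y]. The last clause excludes a third neighbour on
    [p]; if [p] has no repetitions, [f] is thus not adjacent to [y]. *)
Definition bypass p f : Prop := exists A x y z C,
  [/\ p = A ++ [:: x, y, z & C], e f x, e f z
    & forall w, w \in p -> e f w -> w = x \/ w = z].

(* Two bypasses can overlap only as x, z and y, z' on consecutive vertices
   x, y, z, z'; the path x f z y f' z' then visits both. *)
Lemma reroute a r S :
  uniq (a :: r) -> path e a r ->
  (forall f, f \in S -> f \notin a :: r /\ bypass (a :: r) f) ->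
  (forall f g z, f \in S -> g \in S -> z \in a :: r -> e f z -> e g z -> f = g) ->
  exists r', [/\ path e a r', uniq (a :: r'), last a r' = last a r,
    {subset r' <= [predU r & S]} & {subset S <= r'}].
Proof.
have [n] := ubnP (size r); elim: n a r S => // n IHn a r S le_rn uar par byp inj.
have pS z : z \in a :: r -> z \notin S.
  by move=> zp; apply/negP => /byp[]; rewrite zp.
(* A vertex of S that is still to be visited is bypassed on the part q of the
   path that remains once p has been dealt with. *)
have drop_bypass p q S' : a :: r = p ++ q -> S' \subset S ->
    (forall f A x y z C, f \in S' -> p ++ q = A ++ [:: x, y, z & C] ->
       e f x -> e f z -> size p <= size A) ->
    (forall f, f \in S' -> f \notin q /\ bypass q f) /\
    (forall f g z, f \in S' -> g \in S' -> z \in q -> e f z -> e g z -> f = g).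
  move=> Epq /subsetP sS le_p; split=> [f fS'|f g z fS' gS' zq]; last first.
    by apply: inj; rewrite ?sS // Epq mem_cat zq orbT.
  have [fn [A [x [y [z [C [E fx fz only]]]]]]] := byp f (sS f fS').
  rewrite Epq in fn E only; split.
    by apply: contraNN fn => fq; rewrite mem_cat fq orbT.
  have le_pA := le_p f _ _ _ _ _ fS' E fx fz.
  exists (drop (size p) A), x, y, z, C; split=> //; last first.
    by move=> w wq; apply: only; rewrite mem_cat wq orbT.
  have := congr1 (drop (size p)) E; rewrite (drop_size_cat q (erefl (size p))) => ->.
  rewrite drop_cat; case: ltnP => // ge; have -> : size p - size A = 0 by lia.
  by rewrite drop0 drop_oversize.
(* Does some [f] bypass the second vertex of the path? *)
case: (boolP [exists f in S, if r is _ :: c :: _ then e f a && e f c else false]).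
  move=> /exists_inP[f fS]; case: r => [//|b [//|c r]] /= in le_rn uar par byp inj pS drop_bypass *.
  move=> /andP[fa fc]; have /and3P[ab bc cr] := par.
  have [fn [Af [xf [yf [zf [Cf [_ _ _ fonly]]]]]]] := byp f fS.
  have fb : e f b = false.
    apply/negP => fb; move: uar.
    have ap : a \in [:: a, b, c & r] by rewrite mem_head.
    have bp : b \in [:: a, b, c & r] by rewrite !inE eqxx orbT.
    have cp : c \in [:: a, b, c & r] by rewrite !inE eqxx !orbT.
    have [-> | ->] := fonly a ap fa; have [-> | ->] := fonly b bp fb;
    by have [-> | ->] := fonly c cp fc; rewrite !inE eqxx ?orbT ?andbF.
  (* If some [g] bypasses [c] as well, the new path begins with [a], [f], [c], [b], [g], [d], and
     the induction resumes at [d]. *)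
  case: (boolP [exists g in S, if r is d :: _ then e g b && e g d else false]).
    move=> /exists_inP[g gS].
    case: r => [//|d r] /= in le_rn uar par cr byp inj fn fonly pS drop_bypass *.
    move=> /andP[gb gd]; have /andP[cd dr] := cr.
    have gf : g != f by apply: contraFneq fb => <-.
    have [gn _] := byp g gS.
    have [||byp' inj'] := drop_bypass [:: a; b; c] (d :: r) (S :\: [set f; g]) erefl.
    - exact: subsetDl.
    (* Each of [a], [b], [c] has [f] or [g] as its only neighbour in [S], so every other bypass
       starts at [d] or later. *)
    - move=> h A x y z C; rewrite !inE negb_or => /andP[/andP[hf hg] hS].
      case: A => [|a1 [|a2 [|a3 A]]] //= E hx hz.
      + case: E => Ex _ _ _; rewrite -Ex in hx.
        by rewrite (inj h f a) ?eqxx ?mem_head in hf.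
      + case: E => _ Ex _ _ _; rewrite -Ex in hx.
        by rewrite (inj h g b) ?eqxx ?inE ?eqxx ?orbT in hg.
      case: E => _ _ Ex _ _; rewrite -Ex in hx.
      by rewrite (inj h f c) ?eqxx ?inE ?eqxx ?orbT in hf.
    have [||||| r' [pr' ur' lr' sr' Sr']] := IHn d r (S :\: [set f; g]) => //.
    - by clear -le_rn; lia.
    - by case/and4P: uar.
    have nr' z : z \notin r -> z \notin S :\: [set f; g] -> z \notin r'.
      by move=> zr zS; apply/negP => /sr'; rewrite inE /= (negPf zr) (negPf zS).
    exists [:: f, c, b, g, d & r']; split.
    + by rewrite /= [e a f]e_sym fa fc (e_sym c) bc (e_sym b) gb gd pr'.
    + have /perm_uniq P : perm_eq [:: f, g, a, b, c, d & r'] [:: a, f, c, b, g, d & r'].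
        by clear; apply/permP => P /=; lia.
      suff: uniq [:: f, g, a, b, c, d & r'] by rewrite P.
      have SD z : z \in [:: a, b, c, d & r] -> z \notin S :\: [set f; g].
        by move/pS; rewrite inE negb_and orbC => ->.
      have ar := nr' a _ (SD a _); have br := nr' b _ (SD b _); have cr' := nr' c _ (SD c _).
      have fr := nr' f; have gr := nr' g; move: ar br cr' fr gr uar fn gn ur'.
      rewrite /= !inE !eqxx !orbT /= !negb_or [f == g]eq_sym (negPf gf) /=.
      move=> ar br cr' fr gr /and4P[/and4P[-> -> -> /ar -> //]].
      move=> /and3P[-> -> /br -> //] /andP[-> /cr' -> //] _.
      by move=> /and5P[-> -> -> -> /fr -> //] /and5P[-> -> -> -> /gr -> //].
    + by rewrite /= lr'.
    + move=> z; rewrite !inE => /or4P[/eqP->|->|->|/or3P[/eqP->|->|/sr']];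
      rewrite ?fS ?gS ?orbT //.
      by rewrite !inE => /orP[->|/andP[_ ->]]; rewrite ?orbT.
    move=> z zS; have := Sr' z; rewrite !inE zS andbT negb_or.
    by do 2![case: eqVneq => _; rewrite ?orbT //=] => -> //; rewrite ?orbT.
  (* Otherwise [f] replaces [b], which is lost, and the induction resumes at [c]. *)
  rewrite negb_exists_in => /forall_inP ng.
  have [||byp' inj'] := drop_bypass [:: a; b] (c :: r) (S :\ f) erefl.
  - exact: subsetDl.
  - move=> h A x y z C; rewrite !inE => /andP[hf hS].
    case: A => [|a1 [|a2 A]] //= E hx hz.
    + case: E => Ex _ _ _; rewrite -Ex in hx.
      by rewrite (inj h f a) ?eqxx ?mem_head in hf.
    case: E => _ Ex _ Er; rewrite -Ex in hx.
    by have := ng h hS; rewrite Er hx hz.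
  have [||||| r' [pr' ur' lr' sr' Sr']] := IHn c r (S :\ f) => //.
  - by clear -le_rn; lia.
  - by case/and3P: uar.
  have nr' z : z \notin r -> z \notin S :\ f -> z \notin r'.
    by move=> zr zS; apply/negP => /sr'; rewrite inE /= (negPf zr) (negPf zS).
  exists [:: f, c & r']; split.
  + by rewrite /= [e a f]e_sym fa fc pr'.
  + have /perm_uniq P : perm_eq [:: f, a, c & r'] [:: a, f, c & r'].
      by clear; apply/permP => P /=; lia.
    suff: uniq [:: f, a, c & r'] by rewrite P.
    have ar := nr' a; have aS := pS a; have fr := nr' f.
    move: ar aS fr uar fn ur'.
    rewrite /= !inE !eqxx /= !negb_or => ar aS fr.
    move=> /and3P[/and3P[_ -> /ar -> //]]; last by rewrite (negPf (aS _)) // andbF.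
    by move=> _ _ /and4P[-> _ -> /fr -> //] ->.
  + by rewrite /= lr'.
  + move=> z; rewrite !inE => /or3P[/eqP->|->|/sr']; rewrite ?fS ?orbT //.
    by rewrite !inE => /orP[->|/andP[_ ->]]; rewrite ?orbT.
  move=> z zS; have := Sr' z; rewrite !inE zS andbT.
  by case: eqVneq => //= _ ->; rewrite ?orbT.
(* Without such an [f] the first step is kept. A path of a single vertex has no bypass at all. *)
rewrite negb_exists_in => /forall_inP nf.
case: r => [|b r] in le_rn uar par byp inj pS drop_bypass nf *.
  exists [::]; split=> // f /byp[_ [A [x [y [z [C [E _ _ _]]]]]]].
  by have := congr1 size E; rewrite size_cat /=; clear; lia.
have [|byp' inj'] := drop_bypass [:: a] (b :: r) S erefl (subxx S).
- move=> h [|a1 A] x y z C hS //= E hx hz; case: E => Ex _ Er; rewrite -Ex in hx.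
  by have := nf h hS; rewrite Er hx hz.
have /andP[ab br] := par; have /andP[anr ubr] := uar.
have [|r' [pr' ur' lr' sr' Sr']] := IHn b r S _ ubr br byp' inj'.
  by clear -le_rn; move: le_rn => /=; lia.
exists (b :: r'); split=> //.
+ by rewrite /= ab.
+ rewrite cons_uniq ur' andbT.
  rewrite inE negb_or; move: anr; rewrite inE negb_or => /andP[-> /= ar].
  by apply/negP => /sr'; rewrite inE /= (negPf ar) (negPf (pS a (mem_head _ _))).
+ move=> z; rewrite !inE => /orP[->|/sr'] //; rewrite !inE => /orP[->|->];
  by rewrite ?orbT.
by move=> z /Sr'; rewrite inE orbC => ->.
Qed.
End Reroute.


(** * The two shapes of wiggles *)

Section Wiggles.
Variables (T : finType) (G : graph T).

Lemma path_between_sorted a w b :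
  uniq (a :: rcons w b) -> path (adj G) a (rcons w b) ->
  path_between G a b (a :: rcons w b).
Proof. by move=> ? ?; rewrite path_between_cons_rcons; apply/andP. Qed.

(** The edge and the detour through [E] form the spanning cycle, and their lengths differ by
    [size E]. *)
Lemma wiggle_edge a b E :
  adj G a b -> path (adj G) a (rcons E b) -> uniq (a :: rcons E b) ->
  0 < size E <= 2 -> wiggle G [:: a; b] E.
Proof.
move=> ab aE uE sE.
exists a, [::], b, (a :: rcons E b), [:: a; b], (a :: rcons E b); split=> //.
- apply/and3P; split=> //; first by rewrite /= size_rcons; clear -sE; lia.
  by rewrite /= rcons_path aE last_rcons adj_sym.
- by move=> z; rewrite !inE mem_rcons !inE.
- split.
  + by apply: (@path_between_sorted a [::] b); rewrite /= ?ab // inE (adj_neq ab).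
  + exact: path_between_sorted.
  + by move=> z; rewrite !inE orbA => ->.
  by move=> z; rewrite !inE mem_rcons !inE.
rewrite /plength /= size_rcons; clear -sE; lia.
Qed.

(** The paths [a b c d] and [a f c b g d] have lengths 3 and 5, and [a f c d g b] is a spanning
    cycle. *)
Lemma wiggle_crossing a b c d f g :
  uniq [:: a; b; c; d; f; g] ->
  [&& adj G a b, adj G b c & adj G c d] ->
  [&& adj G f a, adj G f c, adj G g b & adj G g d] ->
  wiggle G [:: a; b; c; d] [:: f; g].
Proof.
move=> uw /and3P[ab bc cd] /and4P[fa fc gb gd].
have perm s : perm_eq [:: a; b; c; d; f; g] s -> uniq s /\ s =i [:: a; b; c; d] ++ [:: f; g].
  by move=> ps; split; [rewrite -(perm_uniq ps)|move=> z; rewrite -(perm_mem ps)].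
have [uh hE] : uniq [:: a; f; c; d; g; b] /\ [:: a; f; c; d; g; b] =i [:: a; b; c; d] ++ [:: f; g].
  by apply: perm; clear; apply/permP => P /=; lia.
have [uq qE] : uniq [:: a; f; c; b; g; d] /\ [:: a; f; c; b; g; d] =i [:: a; b; c; d] ++ [:: f; g].
  by apply: perm; clear; apply/permP => P /=; lia.
exists a, [:: b; c], d, [:: a; f; c; d; g; b], [:: a; b; c; d], [:: a; f; c; b; g; d].
split=> //; last by right.
- rewrite /is_cycle uh /= (adj_sym _ a f) fa fc cd (adj_sym _ d g) gd gb.
  by rewrite (adj_sym _ b a) ab.
split.
- apply: (@path_between_sorted a [:: b; c] d); last by rewrite /= ab bc cd.
  by move: uw; rewrite -[[:: a; b; c; d; f; g]]/([:: a; b; c; d] ++ [:: f; g]) cat_uniq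
    => /and3P[].
- apply: (@path_between_sorted a [:: f; c; b; g] d uq).
  by rewrite /= (adj_sym _ a f) fa fc (adj_sym _ c b) bc (adj_sym _ b g) gb gd.
- by move=> z zp; rewrite mem_cat zp.
by move=> z; rewrite qE.
Qed.

End Wiggles.

(** * A leg against the cycle of the other two *)

Section ThetaGood.
Variables (T : finType) (G : graph T) (u v : T).
Implicit Types (t : 'I_3 -> seq T).

Lemma other_legs (i : 'I_3) :
  exists j l, [/\ j != i, l != i, j != l & forall m, m != i -> m = j \/ m = l].
Proof.
pose o1 := @Ordinal 3 1 isT; pose o2 := @Ordinal 3 2 isT.
case: (ord3P i) => ->; [exists o1, o2|exists ord0, o2|exists ord0, o1].
all: split=> // m; case: (ord3P m) => -> //= _; by [left|right].
Qed.

(** The path is the interior of leg [i], and the cycle is formed by the other two legs. *)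
Lemma legs_close_good t i k (X : {set T}) Z :
  theta_legs G u v t -> t i != [::] -> k <= #|X| -> separated X Z ->
  (forall x, x \in X -> exists a m b,
     [/\ a \in t i, exists2 j, j != i & b \in t j, m \notin legs_set u v t,
         adj G a m && adj G m b & {subset [:: a; m; b] <= Z x}]) ->
  k_good k G.
Proof.
move=> tt ti0 kX sXZ XP; have [j [l [ji li jl jlP]]] := other_legs i.
have cE z : (z \in u :: t j ++ v :: rev (t l)) = [|| z == u, z == v, z \in t j | z \in t l].
  by rewrite inE mem_cat inE mem_rev; case: (z == v); rewrite ?orbT.
have [uv _ dt it] := tt.
apply: (@k_close_good _ G (t i) (u :: t j ++ v :: rev (t l)) k X Z) => //.
- exact: (leg_is_path tt).
- exact: (legs_cycle tt).
- rewrite disjoint_subset; apply/subsetP => z zi; rewrite inE cE !negb_or.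
  have /andP[un vn] := end_notin_leg tt i; apply/and4P; split.
  + by apply: contraNneq un => <-.
  + by apply: contraNneq vn => <-.
  + by apply: contraNN ji => zj; apply/eqP; apply: dt zj zi.
  by apply: contraNN li => zl; apply/eqP; apply: dt zl zi.
move=> x /XP[a [m [b [ai [j' j'i bj'] mn amb sZ]]]]; exists a, m, b; split=> //.
  by rewrite cE; case: (jlP j' j'i) bj' => -> ->; rewrite ?orbT.
rewrite cE; apply/andP; split.
  by apply: contraNN mn; apply: leg_in_legs_set.
apply: contraNN mn => /or4P[/eqP->|/eqP->|mj|ml]; apply/legs_setP.
- exact: Or31.
- exact: Or32.
- by apply: Or33; exists j.
by apply: Or33; exists l.
Qed.

(** For [k = 0] no joining paths are needed, only a leg with nonempty interior, and at most one
    interior is empty. *)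
Lemma zero_good t : theta_legs G u v t -> k_good 0 G.
Proof.
move=> tt; have [uv _ dt it] := tt.
have [i ti0] : exists i, t i != [::].
  case: (eqVneq (t ord0) [::]) => [t0|]; last by exists ord0.
  exists (@Ordinal 3 1 isT); apply/negP => /eqP t1.
  by have := it ord0 (@Ordinal 3 1 isT); rewrite t0 t1 => /(_ erefl) /(congr1 val).
by apply: (@legs_close_good t i 0 set0 (fun=> set0)) => // x; rewrite inE.
Qed.

End ThetaGood.


(** * Vertices of low degree and their zones *)

Section Gadgets.
Variables (T : finType) (G : graph T) (u v : T) (t : 'I_3 -> seq T).
Hypothesis cubG : cubic G.
Hypothesis short_t : short_legs G u v t.

Let tt : theta_legs G u v t := proj1 short_t.
Local Notation S := (legs_set u v t).
Local Notation F := (F_set G (legs_graph u v t)).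

Let D := gdelete G (vset (plus_graph G (legs_graph u v t))).
Let X := [set x in vset D | degree D x <= 1].

Lemma F_setP f : f \in F -> f \notin S /\
  exists a b, [/\ a != b, a \in S, b \in S, adj G f a & adj G f b].
Proof.
rewrite inE in_setI in_setC vset_legs_graph => /andP[/andP[_ fS] f2]; split=> //.
have /card_gt1P[a [b []]] := f2; rewrite !in_setI ![_ \in neighbours _ _]inE.
by move=> /andP[fa aS] /andP[fb bS] ab; exists a, b.
Qed.

(** Two of the three edges at [f] go to the theta-graph. *)
Lemma F_off_nbr f x y : f \in F -> x \notin S -> y \notin S ->
  adj G f x -> adj G f y -> x = y.
Proof.
move=> /F_setP[fS [a [b [ab aS bS fa fb]]]] xS yS fx fy; apply/eqP.
case: (eqVneq x y) => // xy.
have off c z : c \in S -> z \notin S -> c != z by move=> cS; apply: contraNneq => <-.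
suff : size [:: a; b; x; y] <= 3 by [].
apply: (cubic_degree cubG (x := f)); last by rewrite /= fa fb fx fy.
by rewrite /= !inE !negb_or ab xy (off a x) ?(off a y) ?(off b x) ?(off b y).
Qed.

(** At most one of the three neighbours of [x] survives in [D], so two lie in the theta-graph or in
    [F]. At most one of them is in the theta-graph, since [x] would otherwise be in [F] itself. *)
Lemma low_degreeP x : x \in X -> [/\ x \notin S, x \notin F &
  exists2 f, f \in F /\ adj G x f & (exists2 a, a \in S & adj G x a) \/
    (exists f', [/\ f' \in F, f' != f & adj G x f'])].
Proof.
have plusE z : (z \in vset (plus_graph G (legs_graph u v t))) =
    (z \in vset G) && ((z \in S) || (z \in F)).
  by rewrite in_setI in_setU vset_legs_graph.
rewrite inE => /andP[xD dx].
have /andP[xV] : (x \in vset G) && (x \notin vset (plus_graph G (legs_graph u v t))).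
  by move: xD; rewrite in_setI in_setC.
rewrite plusE xV /= negb_or => /andP[xS xF].
have degD : neighbours D x = neighbours G x :\: (S :|: F).
  apply/setP => z; rewrite [LHS]in_set adj_induced !in_setC !plusE in_setD in_setU.
  rewrite [z \in neighbours _ _]in_set xV (negPf xS) (negPf xF).
  case: (boolP (adj G x z)) => xz; rewrite ?andbF //= andbT.
  by rewrite (adj_vsetr xz).
have N3 : #|neighbours G x| = 3 by apply: cubG.
have NS : #|neighbours G x :&: S| <= 1.
  rewrite leqNgt; apply: contraNN xF => x2.
  by rewrite inE in_setI in_setC vset_legs_graph x2 xV xS.
have NSF : 2 <= #|neighbours G x :&: (S :|: F)|.
  have := cardsID (S :|: F) (neighbours G x); rewrite N3 -degD.
  by rewrite /degree in dx; clear -dx; lia.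
split=> //; case: (set_0Vmem (neighbours G x :&: S)) => [NS0|[a]].
  have : 1 < #|neighbours G x :&: F| by move: NSF; rewrite setIUr NS0 set0U.
  move/card_gt1P => [f [f' []]]; rewrite !in_setI ![_ \in neighbours _ _]inE.
  move=> /andP[xf fF] /andP[xf' f'F] ff'; exists f => //; right; exists f'.
  by rewrite eq_sym.
rewrite in_setI [a \in _]inE => /andP[xa aS].
have : 0 < #|neighbours G x :&: F|.
  move: NSF; rewrite setIUr cardsU; clear -NS; lia.
rewrite card_gt0 => /set0Pn[f]; rewrite in_setI [f \in neighbours _ _]inE.
by move=> /andP[xf fF]; exists f => //; left; exists a.
Qed.

Definition own x : {set T} := x |: [set f in F | adj G x f].
(** All vertices that the structure built for [x] may use, so that structures of different [x] can
    be combined. *)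
Definition zone x : {set T} := own x :|: [set z in S | [exists o in own x, adj G z o]].

Lemma ownP x o : reflect (o = x \/ (o \in F /\ adj G x o)) (o \in own x).
Proof.
rewrite in_setU1 [o \in [set _ in _ | _]]in_set.
by apply: (iffP orP) => [[/eqP|/andP]|[->|[oF xo]]]; [left|right|left|right; apply/andP].
Qed.

Lemma own_off x o : x \in X -> o \in own x -> o \notin S.
Proof.
by move=> /low_degreeP[xS _ _] /ownP[->|[/F_setP[]]].
Qed.

Lemma zoneP x z : reflect (z \in own x \/ z \in S /\ exists2 o, o \in own x & adj G z o)
                          (z \in zone x).
Proof.
rewrite (in_setU z (own x)) [z \in [set _ in S | _]]in_set.
apply: (iffP orP) => [[zx|/andP[zS /exists_inP]]|[zx|[zS zo]]]; first by left.
- by right.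
- by left.
by right; rewrite zS; apply/exists_inP.
Qed.

Lemma own_zone x o : o \in own x -> o \in zone x.
Proof. by move=> ox; apply/zoneP; left. Qed.

Lemma adj_own_zone x o z : o \in own x -> z \in S -> adj G z o -> z \in zone x.
Proof. by move=> ox zS zo; apply/zoneP; right; split=> //; exists o. Qed.

Lemma own_inj x y z : x \in X -> y \in X -> z \in own x -> z \in own y -> x = y.
Proof.
move=> /low_degreeP[xS xF _] /low_degreeP[yS yF _].
case/ownP=> [->|[zF xz]] /ownP[// zy|[zF' yz]].
- by rewrite zF' in xF.
- by rewrite zy (negPf yF) in zF.
by apply: (F_off_nbr zF) => //; rewrite adj_sym.
Qed.

(** A vertex of the theta-graph with a neighbour off it has only one such neighbour, and a vertex of
    [F] has at most one neighbour off the theta-graph; so each vertex of a zone leads back to a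
    single [x]. *)
Lemma zone_separated : separated X zone.
Proof.
move=> x y z xX yX.
case/zoneP=> [zx|[zS [o ox zo]]] /zoneP[zy|[zS' [o' oy zo']]].
- exact: own_inj xX yX zx zy.
- by have := own_off xX zx; rewrite zS'.
- by have := own_off yX zy; rewrite zS.
have [i zi] := off_nbr_inner tt cubG zS zo (own_off xX ox).
apply: (own_inj xX yX ox).
by rewrite (inner_off_nbr tt cubG zi zo zo' (own_off xX ox) (own_off yX oy)).
Qed.

(** * Positions on a leg *)

Local Notation nt i s := (nth u (t i) s).

(** By minimality, a detour off the theta-graph skips at most as many vertices of the leg as it has
    itself. The bound is one-sided and is used in both directions. *)
Lemma leg_dist i s r e :
  s < size (t i) -> r < size (t i) -> 0 < size e -> uniq e ->
  {in e, forall z, z \notin S} -> path (adj G) (nt i s) (rcons e (nt i r)) ->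
  r <= s + (size e).+1.
Proof.
move=> si ri e0 ue eS pe; case: (leqP r s) => [rs|sr]; first by clear -rs; lia.
have E : t i = take s (t i) ++
    nt i s :: take (r - s.+1) (drop s.+1 (t i)) ++ nt i r :: drop r.+1 (t i).
  have -> : nt i r :: drop r.+1 (t i) = drop (r - s.+1) (drop s.+1 (t i)).
    by rewrite drop_drop subnK // -drop_nth.
  by rewrite cat_take_drop -drop_nth // cat_take_drop.
have := short_leg_exchange short_t E _ ue eS pe.
rewrite -size_eq0 -lt0n e0 => /(_ isT); rewrite size_take size_drop.
clear -si ri sr; case: ifP => _; lia.
Qed.

Lemma off_nbrP f a : f \notin S -> a \in S -> adj G f a ->
  exists i s, s < size (t i) /\ a = nt i s.
Proof.
move=> fS aS fa; have [i ai] : exists i, a \in t i.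
  by apply: (off_nbr_inner tt cubG aS _ fS); rewrite adj_sym.
by exists i, (index a (t i)); rewrite index_mem nth_index.
Qed.

Lemma nt_S i s : s < size (t i) -> nt i s \in S.
Proof. by move=> si; apply: (@leg_in_legs_set _ _ _ _ i); apply: mem_nth. Qed.

Lemma uniq_leg i : uniq (t i).
Proof. by have := legs_uniq tt i; rewrite /leg /= rcons_uniq => /and3P[]. Qed.

Lemma nt_neq i s r : s < size (t i) -> r < size (t i) -> s != r -> nt i s != nt i r.
Proof. by move=> si ri; rewrite nth_uniq // uniq_leg. Qed.

Lemma nt_adj i s : s.+1 < size (t i) -> adj G (nt i s) (nt i s.+1).
Proof.
move=> si; have : sorted (adj G) (t i).
  by have := legs_path tt i; rewrite rcons_path => /andP[/path_sorted].
by move/(sortedP u); apply.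
Qed.

Lemma nt_off_nbr i s x y : s < size (t i) -> x \notin S -> y \notin S ->
  adj G x (nt i s) -> adj G y (nt i s) -> x = y.
Proof.
move=> si xS yS; rewrite ![adj G _ (nt i s)]adj_sym => sx sy.
by apply: (inner_off_nbr tt cubG (mem_nth u si)) sx sy xS yS.
Qed.

Lemma third_leg (i j : 'I_3) : i != j -> exists l, forall m, m != l -> m = i \/ m = j.
Proof.
pose o1 := @Ordinal 3 1 isT; pose o2 := @Ordinal 3 2 isT.
case: (ord3P i) => ->; case: (ord3P j) => -> // _;
  [exists o2|exists o1|exists o2|exists ord0|exists o1|exists ord0];
  by move=> m; case: (ord3P m) => -> // _; by [left|right].
Qed.

(** Naming the leg that is left out describes the two legs that are met by a single index. *)
Definition crosses f l : Prop := forall i, i != l -> exists2 a, a \in t i & adj G f a.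

(** If both neighbours are on one leg, [f] is a detour with one vertex, so at most one vertex lies
    between them. *)
Lemma F_cases f : f \in F -> (exists l, crosses f l) \/
  exists i s d, [/\ s + d < size (t i), d = 1 \/ d = 2, adj G f (nt i s) & adj G f (nt i (s + d))].
Proof.
move=> fF; have [fS [a [b [ab aS bS fa fb]]]] := F_setP fF.
have [i [s [si aE]]] := off_nbrP fS aS fa; have [j [r [rj bE]]] := off_nbrP fS bS fb.
case: (eqVneq i j) => [E|ij]; last first.
  have [l lP] := third_leg ij; left; exists l => m /lP[->|->].
    by exists a => //; rewrite aE mem_nth.
  by exists b => //; rewrite bE mem_nth.
right; subst j a b.
have fS1 : {in [:: f], forall z, z \notin S} by move=> z; rewrite inE => /eqP->.
have dist : r <= s + 2 /\ s <= r + 2.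
  split; apply: (@leg_dist i _ _ [:: f]) => //=.
    by rewrite adj_sym fa fb.
  by rewrite adj_sym fa fb.
have sr : s != r by apply: contraNneq ab => ->.
case: (ltnP s r) => [lt|ge].
  exists i, s, (r - s); split=> //.
  - by clear -lt rj; lia.
  - by clear -lt dist; lia.
  by rewrite subnKC // ltnW.
exists i, r, (s - r); split=> //.
- by clear -ge si; lia.
- by clear -ge sr dist; lia.
by rewrite subnKC.
Qed.

(** The reversed form is included because the cycle through two legs traverses one of them
    backwards. *)
Definition wiggles x i : Prop := exists w E E',
  [/\ wiggle G w E, wiggle G (rev w) E', infix w (t i),
      {subset E <= own x} /\ {subset E' <= own x} & {subset w <= zone x}].

Lemma edge_wiggles x i s E : x \in X -> s.+1 < size (t i) ->
  path (adj G) (nt i s) (rcons E (nt i s.+1)) -> uniq E -> 0 < size E <= 2 ->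
  {subset E <= own x} -> wiggles x i.
Proof.
move=> xX si pE uE sE EO; set a := nt i s in pE *; set b := nt i s.+1 in pE *.
have s1 : s < size (t i) by apply: ltnW.
have ab : adj G a b by apply: nt_adj.
have aS : a \in S by apply: nt_S.
have bS : b \in S by apply: nt_S.
have nE z : z \in S -> z \notin E.
  by move=> zS; apply/negP => /EO /(own_off xX); rewrite zS.
have uaEb : uniq (a :: rcons E b).
  by rewrite /= mem_rcons inE negb_or (adj_neq ab) nE // rcons_uniq nE.
have pR : path (adj G) b (rcons (rev E) a).
  have := rev_path (adj G) a (rcons E b); rewrite last_rcons belast_rcons rev_cons => ->.
  by under eq_path => y z do rewrite adj_sym.
exists [:: a; b], E, (rev E); split.
- exact: wiggle_edge.
- rewrite /rev /=; apply: wiggle_edge => //; rewrite ?size_rev //; first by rewrite adj_sym.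
  by move: uaEb; rewrite -rev_uniq rev_cons rev_rcons.
- have -> : [:: a; b] = take 2 (drop s (t i)).
    by rewrite (drop_nth u) // (drop_nth u si) /= take0.
  by apply: infix_trans (infix_take _ _) (infix_drop _ _).
- by split=> // z; rewrite mem_rev; apply: EO.
(* The ends of the edge belong to the zone as neighbours of the first and the last vertex of [E]. *)
move=> z; rewrite in_cons mem_seq1 => /orP[/eqP->|/eqP->].
  case: (E) sE pE EO => // e E' _ /= /andP[ae _] EO.
  by apply: adj_own_zone ae => //; apply: EO; rewrite mem_head.
case/lastP: (E) sE pE EO => // E' e _; rewrite rcons_path last_rcons => /andP[_ eb] EO.
have eO : e \in own x by apply: EO; rewrite mem_rcons mem_head.
by apply: (adj_own_zone eO) => //; rewrite adj_sym.
Qed.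

Lemma crossing_wiggles x i f g s : x \in X -> f \in own x -> g \in own x ->
  s.+3 < size (t i) -> adj G f (nt i s) -> adj G f (nt i s.+2) ->
  adj G g (nt i s.+1) -> adj G g (nt i s.+3) -> wiggles x i.
Proof.
move=> xX fO gO s3 fa fc gb gd.
have s2 := ltnW s3; have s1 := ltnW s2; have s0 := ltnW s1.
have fS := own_off xX fO; have gS := own_off xX gO.
have ab := nt_adj s1; have bc := nt_adj s2; have cd := nt_adj s3.
have nS z e : z \in S -> e \notin S -> z != e by move=> zS; apply: contraNneq => <-.
have uT : uniq [:: nt i s; nt i s.+1; nt i s.+2; nt i s.+3].
  by rewrite /= !inE !negb_or !nt_neq //; clear; lia.
(* A vertex serving as both would have four neighbours on the leg. *)
have fg : f != g.
  apply/eqP => fg; rewrite -fg in gb gd.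
  by have := cubic_degree cubG uT (x := f); rewrite /= fa fc gb gd => /(_ isT).
have drop4 : [:: nt i s; nt i s.+1; nt i s.+2; nt i s.+3] = take 4 (drop s (t i)).
  by do 4![rewrite (drop_nth u) //]; rewrite /= take0.
have aS := nt_S s0; have bS := nt_S s1; have cS := nt_S s2; have dS := nt_S s3.
move: drop4 uT aS bS cS dS fa fc gb gd ab bc cd.
set a := nt i s; set b := nt i s.+1; set c := nt i s.+2; set d := nt i s.+3.
move=> drop4 uT aS bS cS dS fa fc gb gd ab bc cd.
have u6 : uniq [:: a; b; c; d; f; g].
  rewrite -[[:: a; b; c; d; f; g]]/([:: a; b; c; d] ++ [:: f; g]) cat_uniq uT /=.
  rewrite !inE negb_or fg orbF !(eq_sym f) !(eq_sym g) !negb_or.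
  by rewrite (nS a f) ?(nS b f) ?(nS c f) ?(nS d f) ?(nS a g) ?(nS b g) ?(nS c g) ?(nS d g).
exists [:: a; b; c; d], [:: f; g], [:: g; f]; split.
- by apply: wiggle_crossing; rewrite ?ab ?bc ?cd ?fa ?fc ?gb.
(* Reading the leg backwards exchanges the roles of [f] and [g]. *)
- rewrite /rev /=; apply: wiggle_crossing.
  + have /perm_uniq <- : perm_eq [:: a; b; c; d; f; g] [:: d; c; b; a; g; f].
      by clear; apply/permP => P /=; lia.
    exact: u6.
  + by rewrite (adj_sym _ d) cd (adj_sym _ c) bc (adj_sym _ b) ab.
  by rewrite gd gb fc fa.
- by rewrite drop4; apply: infix_trans (infix_take _ _) (infix_drop _ _).
- by split=> z; rewrite in_cons mem_seq1 => /orP[/eqP->|/eqP->].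
move=> z; rewrite 3!in_cons mem_seq1 => /or4P[] /eqP->.
- by apply: (adj_own_zone fO); rewrite 1?adj_sym.
- by apply: (adj_own_zone gO); rewrite 1?adj_sym.
- by apply: (adj_own_zone fO); rewrite 1?adj_sym.
by apply: (adj_own_zone gO); rewrite 1?adj_sym.
Qed.

(** * The gadget of a vertex of low degree *)

Local Notation bypasses f i := (bypass (adj G) (leg u v t i) f).

(** The third edge of [f] goes to [x], which is off the theta-graph, so [f] has no further neighbour
    on the leg. *)
Lemma index_bypass f x i s : f \notin S -> x \notin S -> adj G f x ->
  s.+2 < size (t i) -> adj G f (nt i s) -> adj G f (nt i s.+2) -> bypasses f i.
Proof.
move=> fS xS fx s2 fa fc; have s1 := ltnW s2; have s0 := ltnW s1.
exists (u :: take s (t i)), (nt i s), (nt i s.+1), (nt i s.+2), (rcons (drop s.+3 (t i)) v).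
split=> // [|w wl fw].
  rewrite -!rcons_cons -!drop_nth // -rcons_cat cat_cons cat_take_drop.
  by [].
case: (eqVneq w (nt i s)) => [|wa]; first by left.
case: (eqVneq w (nt i s.+2)) => [|wc]; first by right.
have nS z : z \in S -> z != x by apply: contraTneq => ->.
suff : size [:: nt i s; nt i s.+2; w; x] <= 3 by [].
apply: (cubic_degree cubG (x := f)); last by rewrite /= fa fc fw fx.
rewrite /= !inE !negb_or !nS ?nt_S ?(leg_sub_legs_set wl) // nt_neq //; last by clear; lia.
by rewrite (eq_sym _ w) wa (eq_sym _ w) wc.
Qed.

(* The leg c.2 is the one left out in the first and the last kind, and the one
   that carries the wiggle or the bypass in the other two. *)
Definition gadget x (c : 'I_4 * 'I_3) : Prop :=
  match val c.1 with
  | 0 => exists2 f, f \in own x & crosses f c.2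
  | 1 => wiggles x c.2
  | 2 => exists f j a, [/\ f \in F, adj G x f, bypasses f c.2, j != c.2 & a \in t j /\ adj G x a]
  | _ => forall i, i != c.2 -> exists f, [/\ f \in F, adj G x f & bypasses f i]
  end.

Lemma gadget_exists x : x \in X -> exists c, gadget x c.
Proof.
move=> xX; have [xS xF [f [fF xf] alt]] := low_degreeP xX.
have xO : x \in own x by apply/ownP; left.
have nbrO g : g \in F -> adj G x g -> g \in own x by move=> gF xg; apply/ownP; right.
(* A neighbour of [x] in [F] gives a crossing or a triangle at once, unless its two neighbours are
   at distance 2 on one leg. *)
have narrow g : g \in F -> adj G x g -> (exists c, gadget x c) \/
    exists i s, [/\ s.+2 < size (t i), adj G g (nt i s) & adj G g (nt i s.+2)].
  move=> gF xg; case: (F_cases gF) => [[l gl]|[i [s [d [sd dE ga gb]]]]].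
    by left; exists (@Ordinal 4 0 isT, l), g => //; apply: nbrO.
  case: dE sd gb => -> sd gb; last by right; exists i, s; rewrite addn2 in sd gb.
  left; exists (@Ordinal 4 1 isT, i); rewrite addn1 in sd gb.
  apply: (@edge_wiggles x i s [:: g]) => //=; first by rewrite adj_sym ga gb.
  by move=> z; rewrite mem_seq1 => /eqP->; apply: nbrO.
have [//|[i [s [s2 fa fc]]]] := narrow f fF xf.
have fS := proj1 (F_setP fF); have fx : adj G f x by rewrite adj_sym.
have s1 := ltnW s2; have s0 := ltnW s1.
have bf := index_bypass fS xS fx s2 fa fc.
have fO := nbrO f fF xf.
have pairO y z : y \in own x -> z \in own x -> {subset [:: y; z] <= own x}.
  by move=> yO zO w; rewrite in_cons mem_seq1 => /orP[/eqP->|/eqP->].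
have offO e : {subset e <= own x} -> {in e, forall z, z \notin S}.
  by move=> eO z /eO/(own_off xX).
have nfx := adj_neq fx; have nxf := adj_neq xf.
case: alt => [[a aS xa]|[g [gF gf xg]]].
  have [j [r [rj aE]]] := off_nbrP xS aS xa; rewrite aE in xa.
  case: (eqVneq j i) => [ji|ji]; last first.
    exists (@Ordinal 4 2 isT, i), f, j, (nt j r); split=> //; split=> //.
    exact: mem_nth.
  subst j; exists (@Ordinal 4 1 isT, i); rewrite /gadget /=.
  have xf2 : {subset [:: x; f] <= own x} by apply: pairO.
  have fx2 : {subset [:: f; x] <= own x} by apply: pairO.
  (* The detours through [f] and [x] have two vertices, which confines [r] between [s - 1] and
     [s + 3]. *)
  have d1 : r <= s + 3.
    apply: (@leg_dist i s r [:: f; x]) => //=; [by rewrite inE nfx|exact: offO|].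
    by rewrite adj_sym fa fx xa.
  have d2 : s.+2 <= r + 3.
    apply: (@leg_dist i r s.+2 [:: x; f]) => //=; [by rewrite inE nxf|exact: offO|].
    by rewrite adj_sym xa xf fc.
  have rs : r != s.
    by apply: contraNneq nfx => rs; rewrite rs in xa; rewrite (nt_off_nbr s0 fS xS fa xa).
  have rs2 : r != s.+2.
    by apply: contraNneq nfx => rs'; rewrite rs' in xa; rewrite (nt_off_nbr s2 fS xS fc xa).
  (* In each remaining position, [r] is next to a neighbour of [f] on the leg, and a 4-cycle through
     [x] and [f] arises. *)
  have [E|[E|E]] : s = r.+1 \/ r = s.+1 \/ r = s.+3 by clear -d1 d2 rs rs2; lia.
  - subst s; apply: (@edge_wiggles x i r [:: x; f]) => //=; last by rewrite inE nxf.
    by rewrite adj_sym xa xf fa.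
  - subst r; apply: (@edge_wiggles x i s [:: f; x]) => //=; last by rewrite inE nfx.
    by rewrite adj_sym fa fx xa.
  subst r; apply: (@edge_wiggles x i s.+2 [:: f; x]) => //=; last by rewrite inE nfx.
  by rewrite adj_sym fc fx xa.
have [//|[j [r [r2 ga gc]]]] := narrow g gF xg.
have gS := proj1 (F_setP gF); have gx : adj G g x by rewrite adj_sym.
have r1 := ltnW r2; have r0 := ltnW r1.
have bg := index_bypass gS xS gx r2 ga gc.
have gO := nbrO g gF xg.
(* Bypasses on two different legs form the last kind of gadget, with the third leg left out. *)
case: (eqVneq j i) => [ji|ji]; last first.
  have [l lP] := third_leg ji; exists (@Ordinal 4 3 isT, l) => m /lP[->|->].
    by exists g.
  by exists f.
subst j; exists (@Ordinal 4 1 isT, i); rewrite /gadget /=.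
have ngx := adj_neq gx; have nxg := adj_neq xg.
have clash q : q < size (t i) -> adj G f (nt i q) -> adj G g (nt i q) -> False.
  by move=> qi fq gq; move/eqP: gf; apply; apply/esym; apply: nt_off_nbr qi fS gS fq gq.
have d1 : r.+2 <= s + 4.
  apply: (@leg_dist i s r.+2 [:: f; x; g]) => //=.
  - by rewrite !inE negb_or nfx eq_sym gf nxg.
  - by apply: offO => z; rewrite 2!in_cons mem_seq1 => /or3P[] /eqP->.
  by rewrite adj_sym fa fx xg gc.
have d2 : s.+2 <= r + 4.
  apply: (@leg_dist i r s.+2 [:: g; x; f]) => //=.
  - by rewrite !inE negb_or ngx gf nxf.
  - by apply: offO => z; rewrite 2!in_cons mem_seq1 => /or3P[] /eqP->.
  by rewrite adj_sym ga gx xf fc.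
have rs : r != s by apply/eqP => rs; rewrite rs in ga; apply: (clash s).
have rs2 : r != s.+2 by apply/eqP => rs'; rewrite rs' in ga; apply: (clash s.+2).
have sr2 : s != r.+2 by apply/eqP => sr; rewrite sr in fa; apply: (clash r.+2).
(* Detours with the three vertices [f], [x], [g] bound the difference of [r] and [s] by 2. As [f]
   and [g] share no neighbour on the leg, it is 1, and the bypasses overlap. *)
have [E|E] : r = s.+1 \/ s = r.+1 by clear -d1 d2 rs rs2 sr2; lia.
  by subst r; apply: (@crossing_wiggles x i f g s).
by subst s; apply: (@crossing_wiggles x i g f r).
Qed.

(** * Assembling the gadgets *)

Lemma bypass_inner f i : f \notin S -> bypasses f i ->
  exists x z, [/\ x != z, x \in t i, z \in t i, adj G f x & adj G f z].
Proof.
move=> fS [A [x [y [z [C [E fx fz _]]]]]].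
have inner w : w \in leg u v t i -> adj G f w -> w \in t i.
  move=> wl fw; have [|j wj] := off_nbr_inner tt cubG (leg_sub_legs_set wl) _ fS.
    by rewrite adj_sym.
  have /andP[un vn] := end_notin_leg tt j.
  move: wl; rewrite mem_leg => /or3P[/eqP wu|/eqP wv|//].
    by rewrite wu (negPf un) in wj.
  by rewrite wv (negPf vn) in wj.
exists x, z; split=> //.
- have := legs_uniq tt i; rewrite E cat_uniq => /and3P[_ _] /=.
  by rewrite !inE !negb_or => /andP[/and3P[]].
- by apply: inner => //; rewrite E mem_cat !inE eqxx !orbT.
by apply: inner => //; rewrite E mem_cat !inE eqxx !orbT.
Qed.

(** Two neighbours inside each of two legs would make four. *)
Lemma bypass_leg_inj f i j : f \notin S -> bypasses f i -> bypasses f j -> i = j.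
Proof.
move=> fS bi bj; apply/eqP; case: (eqVneq i j) => // ij.
have [x [z [xz xi zi fx fz]]] := bypass_inner fS bi.
have [y [w [yw yj wj fy fw]]] := bypass_inner fS bj.
have [_ _ dt _] := tt.
have nij a b : a \in t i -> b \in t j -> a != b.
  by move=> ai bj'; apply: contraNneq ij => ab; rewrite (dt i j a) // ab.
suff : size [:: x; z; y; w] <= 3 by [].
apply: (cubic_degree cubG (x := f)); last by rewrite /= fx fz fy fw.
by rewrite /= !inE !negb_or xz yw !nij.
Qed.

(** The legs are rerouted independently of each other and stay disjoint because no vertex bypasses
    two legs. The last clause protects the vertices of legs without bypasses, as rerouting may lose
    vertices. *)
Lemma reroute_legs (S' : 'I_3 -> {set T}) :
  (forall j f, f \in S' j -> f \notin S /\ bypasses f j) ->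
  exists t', [/\ theta_legs G u v t',
    forall j, {subset t' j <= [predU t j & S' j]}, forall j, {subset S' j <= t' j}
    & forall j, S' j = set0 -> t' j = t j].
Proof.
move=> bS; have [uv bt dt it] := tt.
pose P j (l : seq T) := [/\ path_between G u v (u :: rcons l v),
  {subset l <= [predU t j & S' j]}, {subset S' j <= l} & S' j = set0 -> l = t j].
have [|t' t'P] := @finite_choice _ _ [::] P [set: 'I_3].
  move=> j _; case: (set_0Vmem (S' j)) => [S0|[f0 f0S]].
    exists (t j); split=> //; first exact: bt.
      by move=> z zj; rewrite inE /= zj.
    by move=> z; rewrite S0 inE.
  have [||||r [pr ur lr sr Sr]] := @reroute T (adj G) (@adj_sym T G) u (rcons (t j) v) (S' j).
  - exact: (legs_uniq tt).
  - exact: (legs_path tt).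
  - move=> f fS'; have [fS bf] := bS j f fS'; split=> //.
    by apply: contraNN fS; apply: leg_sub_legs_set.
  - move=> f g z fS' gS' zl fz gz.
    have [fS _] := bS j f fS'; have [gS _] := bS j g gS'.
    rewrite adj_sym in fz; rewrite adj_sym in gz.
    have [i zi] := off_nbr_inner tt cubG (leg_sub_legs_set zl) fz fS.
    exact: (inner_off_nbr tt cubG zi).
  rewrite last_rcons in lr; case/lastP: r => [|l w] in pr ur lr sr Sr *.
    by move: uv; rewrite -lr /= eqxx.
  rewrite last_rcons in lr; subst w.
  exists l; split.
  - by rewrite path_between_cons_rcons pr.
  - move=> z zl; have /sr : z \in rcons l v by rewrite mem_rcons inE zl orbT.
    rewrite !inE mem_rcons inE -orbA => /orP[/eqP zv|//].
    by move: ur; rewrite /= rcons_uniq -zv zl andbF.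
  - move=> f fS'; have := Sr f fS'; rewrite mem_rcons inE => /orP[/eqP fv|//].
    by have [/negP[]] := bS j f fS'; apply/legs_setP/Or32.
  by move=> S0; rewrite S0 inE in f0S.
have {}t'P j := t'P j (in_setT j).
have offt i z : z \in t i -> z \in S by apply: leg_in_legs_set.
have dt' i j z : z \in t' i -> z \in t' j -> i = j.
  have [_ si _ _] := t'P i; have [_ sj _ _] := t'P j.
  move=> /si/orP[] /= zi /sj/orP[] /= zj.
  - exact: dt zi zj.
  - by have [/negP[]] := bS j z zj; apply: offt zi.
  - by have [/negP[]] := bS i z zi; apply: offt zj.
  by apply: (@bypass_leg_inj z); [case: (bS i z zi)|case: (bS i z zi)|case: (bS j z zj)].
exists t'; split.
- split=> // [j|i j E]; first by case: (t'P j).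
  case Ei: (t' i) => [|z l]; last first.
    by apply: (dt' i j z); rewrite -?E Ei mem_head.
  (* An empty new leg has received no vertex, so it is the old one. *)
  have nil m : t' m = [::] -> t m = [::].
    have [_ _ Sm S0m] := t'P m => m0; rewrite -m0 S0m //.
    by apply/setP => z; rewrite inE; apply/negP => /Sm; rewrite m0.
  by apply: it; rewrite !nil // -E.
- by move=> j; case: (t'P j).
- by move=> j; case: (t'P j).
by move=> j; case: (t'P j).
Qed.

(** [J x] is the set of legs to be rerouted for [x], and [g x j] the vertex inserted into leg [j].
    Leg [i] becomes the path; another leg is reached from [x] through an inserted vertex or, if
    nobody reroutes that leg, through a vertex it already had. *)
Lemma reroute_good i k (Y : {set T}) (g : T -> 'I_3 -> T) (J : T -> {set 'I_3}) :
  Y \subset X -> 0 < k -> k <= #|Y| ->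
  (forall x j, x \in Y -> j \in J x ->
     [/\ g x j \in F, adj G x (g x j) & bypasses (g x j) j]) ->
  (forall x, x \in Y -> i \in J x /\ exists2 j, j != i &
     (j \in J x) \/ ((forall y, y \in Y -> j \notin J y) /\
       exists2 a, a \in t j & adj G x a)) ->
  k_good k G.
Proof.
move=> /subsetP YX k0 kY gP YP.
pose S' j := [set f | [exists x in Y, (j \in J x) && (f == g x j)]].
have S'P j f : f \in S' j -> exists2 x, x \in Y /\ j \in J x & f = g x j.
  by rewrite inE => /exists_inP[x xY /andP[xj /eqP->]]; exists x.
have gS' x j : x \in Y -> j \in J x -> g x j \in S' j.
  by move=> xY xj; rewrite inE; apply/exists_inP; exists x; rewrite ?xj /=.
have S'F j f : f \in S' j -> f \in F by case/S'P=> x [xY xj] ->; case: (gP x j).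
have [|t' [tt' st' St' t'0]] := @reroute_legs S'.
  move=> j f fS'; split; first by case: (F_setP (S'F _ _ fS')).
  by case/S'P: fS' => x [xY xj] ->; case: (gP x j).
have gO x j : x \in Y -> j \in J x -> g x j \in own x.
  by move=> xY xj; apply/ownP; right; case: (gP x j).
have [x0 x0Y] : exists x0, x0 \in Y by apply/set0Pn; rewrite -card_gt0; apply: leq_trans kY.
apply: (@legs_close_good _ G u v t' i k Y zone) => //.
- have [ix0 _] := YP _ x0Y; have := St' i _ (gS' _ _ x0Y ix0).
  by case: (t' i).
- by move=> x y z xY yY; apply: zone_separated; apply: YX.
move=> x xY; have xX := YX x xY; have [xS xF _] := low_degreeP xX.
have [ix [j ji alt]] := YP x xY; have [gF xg _] := gP x i xY ix.
have xO : x \in own x by apply/ownP; left.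
have [b [bj bZ xb]] : exists b, [/\ b \in t' j, b \in zone x & adj G x b].
  case: alt => [xj|[nj [a aj xa]]].
    exists (g x j); split; first exact: St' (gS' _ _ xY xj).
      exact: own_zone (gO _ _ xY xj).
    by case: (gP x j xY xj).
  exists a; split=> //; last first.
    by apply: (adj_own_zone xO); [apply: leg_in_legs_set aj|rewrite adj_sym].
  rewrite t'0 //; apply/setP => f; rewrite in_set0; apply/negP => /S'P[y [yY jy] _].
  by have := nj y yY; rewrite jy.
exists (g x i), x, b; split=> //.
- exact: St' (gS' _ _ xY ix).
- by exists j.
- apply/legs_setP => -[xu|xv|[m /st' /orP[/= xm|/= xm]]].
  + by case/negP: xS; apply/legs_setP/Or31.
  + by case/negP: xS; apply/legs_setP/Or32.
  + by case/negP: xS; apply: leg_in_legs_set xm.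
  by rewrite (S'F _ _ xm) in xF.
- by rewrite adj_sym xg.
move=> z; rewrite 2!in_cons mem_seq1 => /or3P[] /eqP-> //.
  exact: own_zone (gO _ _ xY ix).
exact: own_zone.
Qed.

(** As [i] is not the leg left out, [f] itself links leg [i] to one of the other two. *)
Lemma crosses_good i k (Y : {set T}) : Y \subset X -> 0 < k -> k <= #|Y| ->
  (forall x, x \in Y -> exists2 f, f \in own x & exists2 l, l != i & crosses f l) ->
  k_good k G.
Proof.
move=> /subsetP YX k0 kY YP.
have [x0 x0Y] : exists x0, x0 \in Y by apply/set0Pn; rewrite -card_gt0; apply: leq_trans kY.
apply: (@legs_close_good _ G u v t i k Y zone) => //.
- have [f _ [l li fl]] := YP _ x0Y; have [|a] := fl i; first by rewrite eq_sym.
  by case: (t i).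
- by move=> x y z xY yY; apply: zone_separated; apply: YX.
move=> x xY; have [f fO [l li fl]] := YP x xY.
have [|a ai fa] := fl i; first by rewrite eq_sym.
have [j ji jl] : exists2 j, j != i & j != l.
  have [j [m [ji mi jm _]]] := other_legs i.
  by case: (eqVneq j l) => [E|]; [exists m; rewrite // -E eq_sym|exists j].
have [b bj fb] := fl j jl.
exists a, f, b; split=> //.
- by exists j.
- exact: own_off (YX x xY) fO.
- by rewrite adj_sym fa fb.
move=> z; rewrite 2!in_cons mem_seq1 => /or3P[] /eqP->.
- by apply: (adj_own_zone fO); [apply: leg_in_legs_set ai|rewrite adj_sym].
- exact: own_zone.
by apply: (adj_own_zone fO); [apply: leg_in_legs_set bj|rewrite adj_sym].
Qed.

Lemma wiggles_good i k (Y : {set T}) : Y \subset X -> 0 < k -> k <= #|Y| ->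
  (forall x, x \in Y -> exists2 j, j != i & wiggles x j) -> k_good k G.
Proof.
move=> /subsetP YX k0 kY YP; have [j [l [ji li jl jlP]]] := other_legs i.
pose c := u :: t j ++ v :: rev (t l).
have cS z : z \in c -> z \in S.
  rewrite inE mem_cat inE mem_rev => /or4P[/eqP->|zj|/eqP->|zl].
  - by apply/legs_setP/Or31.
  - exact: leg_in_legs_set zj.
  - by apply/legs_setP/Or32.
  exact: leg_in_legs_set zl.
pose P x (wE : seq T * seq T) := [/\ wiggle G wE.1 wE.2, infix wE.1 c,
  {subset wE.1 ++ wE.2 <= zone x} & [disjoint wE.2 & c]].
have [|wE wEP] := @finite_choice _ _ ([::], [::]) P Y.
  move=> x xY; have [m mi [w [E [E' [wE wE' wm [EO EO'] wZ]]]]] := YP x xY.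
  have dE (e : seq T) : {subset e <= own x} -> [disjoint e & c].
    move=> eO; rewrite disjoint_subset; apply/subsetP => z ze; rewrite inE.
    by apply/negP => /cS; apply/negP; apply: own_off (YX x xY) (eO z ze).
  have sZ (w' e : seq T) : {subset w' <= w} -> {subset e <= own x} -> {subset w' ++ e <= zone x}.
    move=> w'w eO z; rewrite mem_cat => /orP[/w'w/wZ //|/eO].
    exact: own_zone.
  (* The cycle [c] runs forwards along leg [j] and backwards along leg [l], where the reversed
     wiggle is taken. *)
  case: (jlP m mi) => Em; subst m.
    exists (w, E); split=> //=; [|exact: sZ|exact: dE].
    exact: (infix_catl [:: u] (infix_catr _ wm)).
  exists (rev w, E'); split=> //=; [|by apply: sZ => // z; rewrite mem_rev|exact: dE].
  by apply: (infix_catl (u :: t j)); apply: (infix_catl [:: v]); rewrite infix_rev.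
apply: (@wiggly_necklace_good _ G c k Y zone (fun x => (wE x).1) (fun x => (wE x).2)) => //.
- exact: (legs_cycle tt).
by move=> x y z xY yY; apply: zone_separated; apply: YX.
Qed.

Lemma low_degree_good k : 8 * k <= #|X| -> k_good k G.
Proof.
case: (posnP k) => [-> _|k0 kX]; first exact: zero_good tt.
have [cd cdP] := finite_choice (ord0, ord0) gadget_exists.
pose m c i := #|[set x in X | (val (cd x).1 == c) && (val (cd x).2 == i)]|.
pose Y c i := [set x in X | (val (cd x).1 == c) && (val (cd x).2 != i)].
have tot : #|X| = \sum_(c < 4) \sum_(i < 3) m c i.
  rewrite pair_bigA /= -sum1_card (partition_big cd predT) //=.
  apply: eq_bigr => p _; rewrite /m -sum1_card; apply: eq_bigl => x.
  by rewrite [in RHS]in_set.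
have mY c i j l : j != i -> l != i -> j != l -> m c j + m c l <= #|Y c i|.
  move=> ji li jl; rewrite /m -cardsUI.
  rewrite [X in _ + #|pred_of_set X|](_ : _ = set0); last first.
    apply/setP => x; rewrite in_set0 in_setI !in_set; apply/negP.
    by case/andP=> /and3P[_ _ /eqP->] /and3P[_ _ jl']; rewrite jl' in jl.
  rewrite cards0 addn0; apply/subset_leq_card/subsetP => x; rewrite in_setU !in_set.
  by case/orP=> /and3P[-> -> /eqP->].
have YX c i : Y c i \subset X by apply/subsetP => x; rewrite in_set => /andP[].
(* Kinds 0, 1 and 3 are collected over all legs except [i], kind 2 only over leg [i] itself. *)
case: (boolP [exists i : 'I_3, [|| k <= #|Y 0 i|, k <= #|Y 1 i|, k <= m 2 i | k <= #|Y 3 i|]]).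
  case/existsP=> i /or4P[] kY.
  - apply: (@crosses_good i k _ (YX 0 i) k0 kY) => x; rewrite in_set => /and3P[xX /eqP c0 ni].
    by have := cdP x xX; rewrite /gadget c0 => -[f fO fl]; exists f => //; exists (cd x).2.
  - apply: (@wiggles_good i k _ (YX 1 i) k0 kY) => x; rewrite in_set => /and3P[xX /eqP c1 ni].
    by have := cdP x xX; rewrite /gadget c1 => wx; exists (cd x).2.
  - pose Z := [set x in X | (val (cd x).1 == 2) && (val (cd x).2 == i)].
    have ZX : Z \subset X by apply/subsetP => x; rewrite in_set => /andP[].
    pose Q x f := [/\ f \in F, adj G x f & bypasses f i] /\
      exists j a, j != i /\ (a \in t j /\ adj G x a).
    have [|g gQ] := @finite_choice _ _ u Q Z.
      move=> x; rewrite in_set => /and3P[xX /eqP c2 /eqP/val_inj ci].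
      have := cdP x xX; rewrite /gadget c2 ci => -[f [j [a [? ? ? ? ?]]]].
      by exists f; split=> //; exists j, a.
    (* Only leg [i] is rerouted, so the neighbours of the vertices of [Z] on other legs are not
       lost. *)
    apply: (@reroute_good i k Z (fun x _ => g x) (fun=> [set i])) => // [x j xZ|x xZ].
      by rewrite in_set1 => /eqP->; case: (gQ x xZ).
    have [_ [j [a [ji [aj xa]]]]] := gQ x xZ.
    rewrite in_set1 eqxx; split=> //; exists j => //; right.
    by split; [move=> y _; rewrite in_set1|exists a].
  pose Q x (g : 'I_3 -> T) := forall j, j != (cd x).2 ->
    [/\ g j \in F, adj G x (g j) & bypasses (g j) j].
  have [|g gQ] := @finite_choice _ _ (fun=> u) Q (Y 3 i).
    move=> x; rewrite in_set => /and3P[xX /eqP c3 _].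
    have := cdP x xX; rewrite /gadget c3 => xP.
    pose R j f := [/\ f \in F, adj G x f & bypasses f j].
    have [j|g gR] := @finite_choice _ _ u R [set~ (cd x).2].
      by rewrite in_setC1 => /xP.
    by exists g => j jc; apply: gR; rewrite in_setC1.
  apply: (@reroute_good i k (Y 3 i) g (fun x => [set~ (cd x).2])) => // [x j xY|x xY].
    by rewrite in_setC1; apply: gQ.
  have ni : i != (cd x).2.
    by move: xY; rewrite in_set => /and3P[_ _ ni]; rewrite eq_sym.
  rewrite in_setC1 ni; split=> //.
  (* At least one of the other two legs is not left out for [x] and is therefore rerouted for [x] as
     well. *)
  have [j [l [ji li jl _]]] := other_legs i.
  case: (eqVneq j (cd x).2) => [E|nj]; last by exists j => //; left; rewrite in_setC1.
  by exists l => //; left; rewrite in_setC1 -E eq_sym.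
rewrite negb_exists => /forallP lt_k; exfalso.
have lt c i : i < 3 -> c \in [:: 0; 1; 3] -> #|Y c i| < k.
  move=> i3; have := lt_k (Ordinal i3); rewrite !negb_or -!ltnNge /= => /and4P[? ? ? ?].
  by rewrite !inE => /or3P[] /eqP->.
have lt2 i : i < 3 -> m 2 i < k.
  by move=> i3; have := lt_k (Ordinal i3); rewrite !negb_or -!ltnNge /= => /and4P[].
(* Every vertex of kind [c] is in two of the three sets [Y c i], each of which has at most [k.-1]
   elements. *)
have L c : c \in [:: 0; 1; 3] -> 2 * (m c 0 + m c 1 + m c 2) <= 3 * k.-1.
  move=> cc; have := mY c 0 1 2 isT isT isT; have := mY c 1 0 2 isT isT isT.
  have := mY c 2 0 1 isT isT isT; have := lt c 0 isT cc; have := lt c 1 isT cc.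
  have := lt c 2 isT cc; clear; lia.
(* Twice the size of [X] is at most three times [3 * k.-1] plus [6 * k.-1], that is [15 * k.-1],
   which is less than [16 * k]. *)
have := L 0 isT; have := L 1 isT; have := L 3 isT.
have := lt2 0 isT; have := lt2 1 isT; have := lt2 2 isT; move: kX tot.
rewrite !big_ord_recl !big_ord0 /= /bump /= !addn0 !add1n; clear -k0; lia.
Qed.

End Gadgets.

Theorem theorem5p5 (k : nat) (T : finType) (G : graph T) (P1 P2 P3 : seq T) :
  k_connected 3 G -> cubic G -> short_theta G P1 P2 P3 ->
  let D := gdelete G (vset (plus_graph G (theta_graph P1 P2 P3))) in
  8 * k <= #|[set x in vset D | degree D x <= 1]| ->
  k_good k G.
Proof.
move=> _ cubG /short_theta_legs[u [v [t [short_t ->]]]] D.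
exact: low_degree_good cubG short_t k.
Qed.
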